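(* For every finite set $J$ with $|J| \geq 2$ and every $\delta > 0$, there exists $c > 0$ such that the following holds. Let $Z = Z^{(N)}$, $Z' = Z'^{(N)}$ be finite additive (abelian) groups and let $(\phi_j)_{j \in J}$ be group homomorphisms $\phi_j : Z \to Z'$ such that the elements $\{\phi_i(d) - \phi_j(d) : i, j \in J,\ d \in Z\}$ generate $Z'$ as an abelian group. Let $\nu = \nu^{(N)} : Z' \to \mathbb{R}_{\geq 0}$ be nonnegative functions with the property that, in the hypergraph system $V = (J, (V_j)_{j \in J}, r, H)$ with $V_j := Z$, $r := |J| - 1$ and $H := \binom{J}{r}$, the weighted hypergraph $(\nu_e)_{e \in H}$ defined by $$\nu_{J \setminus \{j\}}\bigl((x_i)_{i \in J \setminus \{j\}}\bigr) := \nu\Bigl( \sum_{i \in J \setminus \{j\}} (\phi_i(x_i) - \phi_j(x_i)) \Bigr)$$ satisfies the $H$-linear forms condition with rate $\tau$. Then there is $N_0$, depending only on $J$, $\delta$ and $\tau$, such that for every $N \geq N_0$ and every $f : Z' \to \mathbb{R}_{\geq 0}$ satisfying $0 \leq f(x) \leq \nu(x)$ for all $x \in Z'$ and $\mathbb{E}[f] \geq \delta$, $$\mathbb{E}\Bigl[ \prod_{j \in J} f(a + \phi_j(d)) \Big| a \in Z',\ d \in Z \Bigr] \geq c.$$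
   Context: All data $Z, Z', \phi_j, \nu$ may depend on a parameter $N$ (suppressed), with $J$ fixed. $\mathbb{E}[\,\cdot \mid \cdots]$ is the average over the indicated variables, chosen uniformly and independently; $\mathbb{E}[f]$ is the average of $f$ over $Z'$. A hypergraph system is a quadruple $V = (J, (V_j)_{j\in J}, r, H)$, where $J$ is a finite set, the $V_j$ are finite non-empty sets, $r \geq 1$ is an integer, and $H \subseteq \binom{J}{r} := \{e \subseteq J : |e| = r\}$. For $e \subseteq J$ put $V_e := \prod_{j \in e} V_j$. A weighted hypergraph on $V$ is a collection $(\nu_e)_{e \in H}$ of functions $\nu_e : V_e \to \mathbb{R}_{\geq 0}$. Linear forms condition: for $\omega \in \{0,1\}^e$ write $x_e^{(\omega)} := (x_j^{(\omega_j)})_{j \in e}$. The family $(\nu_e)_{e\in H} = (\nu_e^{(N)})_{e \in H}$ satisfies the $H$-linear forms condition with rate $\tau$, where $\tau(N) \to 0$ as $N \to \infty$, if for every choice of exponents $n_{e,\omega} \in \{0,1\}$ and every $N$, $$\Bigl| \mathbb{E}\Bigl[\prod_{e \in H} \prod_{\omega \in \{0,1\}^e} \nu_e(x_e^{(\omega)})^{n_{e,\omega}} \Big| x_J^{(0)}, x_J^{(1)} \in V_J \Bigr] - 1 \Bigr| \leq \tau(N).$$ In other words each such expectation is $1+o(1)$, and $\tau$ bounds the $o(1)$ term. *)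

(* Defs.v *)
From HB Require Import structures.
From mathcomp Require Import all_boot all_order all_algebra all_fingroup.
From mathcomp Require Import all_classical all_reals all_analysis.

Set Implicit Arguments.
Unset Strict Implicit.
Unset Printing Implicit Defensive.

Import Order.TTheory GRing.Theory Num.Theory.
Local Open Scope ring_scope.

Definition mean (R : realType) (T : finType) (f : T -> R) : R :=
  (\sum_x f x) / #|T|%:R.

Record hypergraph_system := HypergraphSystem {
  hsJ : finType;
  hsV : hsJ -> finType;
  hsr : nat;
  hsH : {set {set hsJ}};
  hsV_gt0 : forall j, (0 < #|hsV j|)%N;
  hsr_gt0 : (0 < hsr)%N;
  hsH_card : forall e, e \in hsH -> #|e| = hsr
}.

(* The product V_e of the V_j for j in e: its points are dependent functions
   on the subtype of the elements of e. *)
Definition Vprod (V : hypergraph_system) (e : {set hsJ V}) : finType :=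
  {dffun forall j : {j : hsJ V | j \in e}, hsV (val j)}.

Definition Vfull (V : hypergraph_system) : finType :=
  {dffun forall j : hsJ V, hsV j}.

Record weighted_hypergraph (R : realType) (V : hypergraph_system) :=
  WeightedHypergraph {
  weight :> forall e : {e : {set hsJ V} | e \in hsH V}, Vprod (val e) -> R;
  weight_ge0 : forall e (x : Vprod (val e)), 0 <= weight x
}.

(* The point x_e^(omega), where x is the pair (x_J^(0), x_J^(1)) and the bits
   0, 1 are false, true. *)
Definition cube_point (V : hypergraph_system) (e : {set hsJ V})
    (x : Vfull V * Vfull V) (omega : {ffun {j : hsJ V | j \in e} -> bool}) :
    Vprod e :=
  finfun (fun j : {j : hsJ V | j \in e} =>
            (if omega j then x.2 else x.1) (val j)).

Definition linear_forms_condition (R : realType)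
    (V : nat -> hypergraph_system) (nu : forall N, weighted_hypergraph R (V N))
    (tau : nat -> R) : Prop :=
  forall (N : nat)
    (n : forall e : {e : {set hsJ (V N)} | e \in hsH (V N)},
         {ffun {j : hsJ (V N) | j \in val e} -> bool} -> bool),
  `| mean (fun x : Vfull (V N) * Vfull (V N) =>
       \prod_(e : {e : {set hsJ (V N)} | e \in hsH (V N)})
       \prod_(omega : {ffun {j : hsJ (V N) | j \in val e} -> bool})
         nu N e (cube_point x omega) ^+ n e omega) - 1 | <= tau N.

Section Simplex.
Variables (J : finType) (J_gt1 : (1 < #|J|)%N).

Lemma simplex_r_gt0 : (0 < #|J|.-1)%N.
Proof. by case: #|J| J_gt1 => [|[]]. Qed.

Lemma simplex_H_card (e : {set J}) :
  e \in [set e : {set J} | #|e| == #|J|.-1]%SET -> #|e| = #|J|.-1.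
Proof. by rewrite inE => /eqP. Qed.

Lemma finZmod_card_gt0 (Z : finZmodType) : (0 < #|Z|)%N.
Proof. by apply/card_gt0P; exists 0. Qed.

Definition simplex_system (Z : finZmodType) : hypergraph_system :=
  @HypergraphSystem J (fun=> Z) #|J|.-1 [set e : {set J} | #|e| == #|J|.-1]%SET
    (fun=> finZmod_card_gt0 Z) simplex_r_gt0 simplex_H_card.

Variables (R : realType) (Z Z' : finZmodType) (phi : J -> {additive Z -> Z'}).
Variables (nu : Z' -> R) (nu_ge0 : forall x, 0 <= nu x).

(* Every edge of the simplex system is J \ {j} for a unique j, which is
   recovered as the element picked outside e; see simplex_weight_funE. *)
Definition simplex_weight_fun (e : {set J})
    (x : @Vprod (simplex_system Z) e) : R :=
  if [pick j | j \notin e] is Some j then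
    nu (\sum_(i : {i : J | i \in e})
          (phi (val i) (x i) - phi j (x i)))
  else 0.

Lemma simplex_weight_funE (j : J) (x : @Vprod (simplex_system Z) (~: [set j])) :
  simplex_weight_fun x =
  nu (\sum_(i : {i : J | i \in ~: [set j]}) (phi (val i) (x i) - phi j (x i))).
Proof.
rewrite /simplex_weight_fun; case: pickP => [k|/(_ j)]; rewrite !inE negbK.
  by move/eqP->.
by rewrite eqxx.
Qed.

Lemma simplex_weight_fun_ge0 (e : {set J}) (x : @Vprod (simplex_system Z) e) :
  0 <= simplex_weight_fun x.
Proof. by rewrite /simplex_weight_fun; case: pickP. Qed.

Definition simplex_weight : weighted_hypergraph R (simplex_system Z) :=
  @WeightedHypergraph R (simplex_system Z)
    (fun e x => simplex_weight_fun x) (fun e x => simplex_weight_fun_ge0 x).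

End Simplex.

(* Main.v *)
Require Import Defs.
From HB Require Import structures.
From mathcomp Require Import all_boot all_order all_algebra all_fingroup.
From mathcomp Require Import all_classical all_reals all_analysis.
From mathcomp Require Import ring lra.

Set Implicit Arguments.
Unset Strict Implicit.
Unset Printing Implicit Defensive.

Import Order.TTheory GRing.Theory Num.Theory.
Import numFieldNormedType.Exports.
Local Open Scope ring_scope.

(** Why the theorem holds.

    Put [L_j x = \sum_i (phi i (x i) - phi j (x i))] for [x] in [Z ^ J]. Then
    [L_j x = a + phi j d] with [a = \sum_i phi i (x i)] and [d = - \sum_i x i], so
    the configurations [a + phi j d] are the images of the simplices of a
    hypergraph with vertex classes [Z], whose face opposite to [j] carries the
    weight [f (L_j x)], bounded by [nu (L_j x)]. The generation hypothesis makes
    this parametrization onto, hence uniform (mean_configurations). The points with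
    [\sum_i x i = 0] give degenerate simplices ([d = 0]): there all [L_j x] agree.
    If edges are removed so that no simplex survives, each degenerate simplex loses
    an edge, and projecting the hyperplane of these points to the faces shows that
    the weight of the removed edges is at least the mean of [f] (mean_le_removed).
    It remains to show that few weighted simplices can be destroyed by removing
    edges of small weight.

    A failure for every constant produces a sequence of counterexamples with errors
    tending to 0, and the argument runs along an ultrafilter on its indices
    (no_counterexamples): quantities that tend to 0 are null, bounded complexity
    means a number of colours independent of [N], and no quantitative dependence
    between errors has to be tracked. The role of sigma-algebras is played by the
    L1 closure of the functions that depend on boundedly many sets of fewer than
    [d] coordinates each; the conditional expectation on it is obtained by
    maximizing a quadratic functional (projection, conditional_expectation).

    There are two halves. First, densification. By the linear forms condition each
    majorant is orthogonal to the algebra of level [|J| - 1] of its face, that is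
    to products of functions missing one further coordinate (strong_linear_forms,
    majorant_orth). The conditional expectations [g_j] of the weights therefore have
    values in the unit interval, and counting simplices in the weights or in the
    [g_j] gives the same result (relative_counting): averaging out the vertex
    opposite to a sparse face turns the other factors into a function that is
    almost bounded, so the sparse faces can be treated one at a time.

    Second, removal for the [g_j], with removed sets of bounded complexity at the
    same level (removal), so that removing them costs the same in [g_j] as in the
    original weight. This goes by induction on the level. The functions are nearly
    unions of atoms of a finite colouring by sets of [d] coordinates. Two sets of
    [d] coordinates share fewer than [d] of them, so given the lower levels the
    colours are independent (replace_by_projection). On each atom of the whole
    simplex the places where, given the lower levels, every function keeps most of
    its part of the atom have null intersection, because a positive proportion of
    that intersection would lie in the support of the product (good_null). Those
    places are measurable one level lower, and the induction hypothesis removes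
    them. *)

(** * Averages over finite sets *)

Section Mean.
Variable R : realType.

Lemma eq_mean (T : finType) (f g : T -> R) : f =1 g -> mean f = mean g.
Proof. by move=> fg; rewrite /mean; congr (_ / _); apply: eq_bigr. Qed.

Lemma meanD (T : finType) (f g : T -> R) :
  mean (fun x => f x + g x) = mean f + mean g.
Proof. by rewrite /mean big_split /= mulrDl. Qed.

Lemma meanZ (T : finType) a (f : T -> R) :
  mean (fun x => a * f x) = a * mean f.
Proof. by rewrite /mean -mulr_sumr mulrA. Qed.

Lemma meanZr (T : finType) a (f : T -> R) :
  mean (fun x => f x * a) = mean f * a.
Proof. by rewrite mulrC -meanZ; apply: eq_mean => x; rewrite mulrC. Qed.

Lemma meanN (T : finType) (f : T -> R) : mean (fun x => - f x) = - mean f.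
Proof. by rewrite /mean -mulNr sumrN. Qed.

Lemma meanB (T : finType) (f g : T -> R) :
  mean (fun x => f x - g x) = mean f - mean g.
Proof. by rewrite meanD meanN. Qed.

Lemma mean_sum (T I : finType) (P : pred I) (F : I -> T -> R) :
  mean (fun x => \sum_(i | P i) F i x) = \sum_(i | P i) mean (F i).
Proof. by rewrite /mean exchange_big /= mulr_suml. Qed.

Lemma mean_cst (T : finType) (a : R) : (0 < #|T|)%N -> mean (fun _ : T => a) = a.
Proof.
move=> T0; rewrite /mean sumr_const -[a *+ _]mulr_natr mulfK //.
by rewrite pnatr_eq0 -lt0n.
Qed.

Lemma ler_mean (T : finType) (f g : T -> R) :
  (forall x, f x <= g x) -> mean f <= mean g.
Proof. by move=> fg; rewrite /mean ler_wpM2r ?invr_ge0// ler_sum. Qed.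

Lemma mean_ge0 (T : finType) (f : T -> R) : (forall x, 0 <= f x) -> 0 <= mean f.
Proof. by move=> f0; rewrite /mean divr_ge0// sumr_ge0. Qed.

Lemma mean_le_cst (T : finType) (f : T -> R) a : (0 < #|T|)%N ->
  (forall x, f x <= a) -> mean f <= a.
Proof. by move=> T0 fa; rewrite -[leRHS](mean_cst a T0) ler_mean. Qed.

Lemma ler_norm_mean (T : finType) (f : T -> R) :
  `|mean f| <= mean (fun x => `|f x|).
Proof.
by rewrite /mean normrM normfV normr_nat ler_wpM2r ?invr_ge0// ler_norm_sum.
Qed.

Lemma mean_reindex (T T' : finType) (h : T -> T') (f : T' -> R) :
  bijective h -> mean (fun x => f (h x)) = mean f.
Proof.
move=> bh; rewrite /mean (bij_eq_card bh); congr (_ / _).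
by rewrite [RHS](reindex h)//; apply: onW_bij.
Qed.

Lemma mean_pair (T T' : finType) (f : T -> T' -> R) :
  mean (fun p : T * T' => f p.1 p.2) = mean (fun x => mean (fun y => f x y)).
Proof.
rewrite /mean -(pair_bigA _ f) /= card_prod natrM invfM mulrA.
by rewrite -[in RHS]mulr_suml mulrAC.
Qed.

Lemma mean_exchange (T T' : finType) (f : T -> T' -> R) :
  mean (fun x => mean (fun y => f x y)) = mean (fun y => mean (fun x => f x y)).
Proof.
rewrite -!mean_pair.
rewrite -(mean_reindex (h := fun p => (p.2, p.1)) (fun p => f p.2 p.1)) //.
by exists (fun p => (p.2, p.1)) => -[].
Qed.

Lemma mean_le_max (T : finType) (f : T -> R) : (0 < #|T|)%N ->
  exists x, mean f <= f x.
Proof.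
move=> T0; apply/not_existsP => H; have {}H x : f x < mean f.
  by rewrite ltNge; apply/negP/H.
have /card_gt0P[x0 _] := T0.
suff : mean f < mean f by rewrite ltxx.
rewrite -[ltRHS](mean_cst _ T0) {1}/mean /mean ltr_pM2r ?invr_gt0 ?ltr0n//.
by apply: ltr_sum => //; apply/hasP; exists x0; rewrite // mem_index_enum.
Qed.

End Mean.

(** * Coordinates *)

Section Coordinates.
Variables (K T : finType).
Implicit Types (e : {set K}) (x y : {ffun K -> T}) (a b : K) (t : T).

Definition dep (W : Type) e (f : {ffun K -> T} -> W) :=
  forall x y, {in e, x =1 y} -> f x = f y.

Definition upd x a t : {ffun K -> T} := [ffun k => if k == a then t else x k].

(** The point that follows [x] on the coordinates in [e] and [y] elsewhere. *)
Definition splice e x y : {ffun K -> T} := [ffun k => if k \in e then x k else y k].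

Lemma dep_sub (W : Type) e e' (f : {ffun K -> T} -> W) :
  e \subset e' -> dep e f -> dep e' f.
Proof. by move=> /fintype.subsetP ee' ef x y xy; apply: ef => k /ee' /xy. Qed.

Lemma dep_upd (W : Type) e (f : {ffun K -> T} -> W) x a t :
  dep e f -> a \notin e -> f (upd x a t) = f x.
Proof.
by move=> ef ae; apply: ef => k ke; rewrite ffunE; case: eqP ke ae => // -> ->.
Qed.

(** Resampling one coordinate does not change an average: exchanging the
    coordinate with its replacement is an involution. *)
Lemma mean_upd (R : realType) (f : {ffun K -> T} -> R) a :
  mean f = mean (fun x => mean (fun t => f (upd x a t))).
Proof.
case: (posnP #|T|) => [T0|T0].
  have noX : {ffun K -> T} -> False by move=> x; have := card0_eq T0 (x a).
  by apply: eq_mean => x; case: (noX x).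
rewrite -mean_pair.
pose s (p : {ffun K -> T} * T) := (upd p.1 a p.2, p.1 a).
have sK : involutive s.
  case=> x t; congr (_, _); last by rewrite /= ffunE eqxx.
  by apply/ffunP => k; rewrite !ffunE; case: eqP => [->|].
rewrite -(mean_reindex _ (inv_bij sK)).
rewrite (mean_pair (fun x t => f (upd (s (x, t)).1 a (s (x, t)).2))).
apply: eq_mean => x; rewrite -[LHS](mean_cst _ T0); apply: eq_mean => t /=.
by congr f; apply/ffunP => k; rewrite !ffunE; case: eqP => [->|].
Qed.

Lemma mean_splice (R : realType) (f : {ffun K -> T} -> R) e :
  mean f = mean (fun y => mean (fun x => f (splice e x y))).
Proof.
case: (posnP #|{: {ffun K -> T}}|) => [T0|T0].
  by apply: eq_mean => x; have := card0_eq T0 x.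
rewrite -mean_pair.
pose s (p : {ffun K -> T} * {ffun K -> T}) := (splice e p.1 p.2, splice e p.2 p.1).
have sK : involutive s.
  by case=> x t; congr (_, _); apply/ffunP => k; rewrite !ffunE; case: (k \in e).
rewrite -(mean_reindex _ (inv_bij sK)).
rewrite (mean_pair (fun y x => f (splice e (s (y, x)).2 (s (y, x)).1))).
rewrite mean_exchange.
apply: eq_mean => x; rewrite -[LHS](mean_cst _ T0); apply: eq_mean => t /=.
by congr f; apply/ffunP => k; rewrite !ffunE; case: (k \in e).
Qed.

End Coordinates.

(** * Null sequences along a filter *)

Section Null.
Variables (R : realType) (U : set_system nat).
Context {FU : Filter U}.
Implicit Types u v w : nat -> R.

(** Convergence to 0 along [U], with explicit errors; for an ultrafilter these are
    the infinitesimals of the ultrapower of the reals. *)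
Definition nul u := forall eps, 0 < eps -> \forall N \near U, `|u N| <= eps.

Lemma eq_nul u v : u =1 v -> nul u -> nul v.
Proof. by move=> uv nu eps e0; apply: filterS (nu _ e0) => N; rewrite uv. Qed.

Lemma nul_le u v : (\forall N \near U, `|u N| <= v N) -> nul v -> nul u.
Proof.
move=> uv nv eps e0; apply: filterS2 uv (nv _ e0) => N /le_trans uv vN.
by apply: uv; apply: le_trans vN; apply: ler_norm.
Qed.

Lemma nul0 : nul (fun=> 0).
Proof. by move=> eps e0; apply: nearW => N; rewrite normr0 ltW. Qed.

Lemma nulN u : nul u -> nul (fun N => - u N).
Proof. by move=> nu eps e0; apply: filterS (nu _ e0) => N; rewrite normrN. Qed.

Lemma nulD u v : nul u -> nul v -> nul (fun N => u N + v N).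
Proof.
move=> nu nv eps e0; have e2 : 0 < eps / 2 by rewrite divr_gt0.
apply: filterS2 (nu _ e2) (nv _ e2) => N uN vN.
by rewrite (le_trans (ler_normD _ _))// [leRHS]splitr lerD.
Qed.

Lemma nulB u v : nul u -> nul v -> nul (fun N => u N - v N).
Proof. by move=> nu nv; apply: nulD => //; apply: nulN. Qed.

Lemma nulM (M : R) b u : (\forall N \near U, `|b N| <= M) -> nul u ->
  nul (fun N => b N * u N).
Proof.
move=> bM nu eps e0; have M0 : 0 < `|M| + 1 by rewrite ltr_wpDl.
have e2 : 0 < eps / (`|M| + 1) by rewrite divr_gt0.
apply: filterS2 bM (nu _ e2) => N bN uN; rewrite normrM.
rewrite (@le_trans _ _ ((`|M| + 1) * (eps / (`|M| + 1))))//; last first.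
  by rewrite mulrCA divff ?mulr1 ?gt_eqF.
apply: ler_pM => //; rewrite (le_trans bN)// (le_trans (ler_norm M))//.
by rewrite lerDl.
Qed.

Lemma nulZ a u : nul u -> nul (fun N => a * u N).
Proof. by apply: (@nulM `|a| (fun=> a)); apply: nearW. Qed.

Lemma nul_sum (I : finType) (P : pred I) (u : I -> nat -> R) :
  (forall i, P i -> nul (u i)) -> nul (fun N => \sum_(i | P i) u i N).
Proof.
move=> nu; rewrite /index_enum; elim: (Finite.enum I) => [|i s IH].
  by apply: (eq_nul _ nul0) => N; rewrite big_nil.
have [Pi|Pi] := boolP (P i); last first.
  by apply: (eq_nul _ IH) => N; rewrite big_cons (negbTE Pi).
by apply: (eq_nul _ (nulD (nu _ Pi) IH)) => N; rewrite big_cons Pi.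
Qed.

Lemma nul_approx (M : R) u : (forall eps, 0 < eps -> exists2 v, nul v &
  \forall N \near U, `|u N - v N| <= M * eps) -> nul u.
Proof.
move=> H eps e0; have M0 : 0 < `|M| + 1 by rewrite ltr_wpDl.
have e2 : 0 < eps / 2 / (`|M| + 1) by rewrite !divr_gt0.
have [v nv uv] := H _ e2; have e3 : 0 < eps / 2 by rewrite divr_gt0.
apply: filterS2 uv (nv _ e3) => N uvN vN.
rewrite -(subrK (v N) (u N)) (le_trans (ler_normD _ _))// [leRHS]splitr lerD//.
rewrite (le_trans uvN)// -[leRHS](divfK (lt0r_neq0 M0)) mulrC (ler_wpM2l (ltW e2))//.
by rewrite (le_trans (ler_norm M))// lerDl.
Qed.

Lemma nul_small (M : R) u : (forall eps, 0 < eps -> eps <= 1 ->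
  \forall N \near U, `|u N| <= M * eps) -> nul u.
Proof.
move=> H; apply: (@nul_approx `|M|) => eps e0; exists (fun=> 0); first exact: nul0.
have m0 : 0 < Num.min eps 1 by rewrite lt_min e0 ltr01.
apply: filterS (H _ m0 _) => [N uN|]; last by rewrite ge_min lexx orbT.
rewrite subr0 (le_trans uN)// (@le_trans _ _ (`|M| * Num.min eps 1))//.
  by rewrite ler_wpM2r// ?ler_norm// ltW.
by rewrite ler_wpM2l// ge_min lexx.
Qed.

Lemma nul_near_le u (M : R) : nul (fun N => u N - M) ->
  \forall N \near U, u N <= M + 1.
Proof.
move=> nu; apply: filterS (nu _ ltr01) => N; rewrite ler_norml => /andP[_].
by rewrite lerBlDl.
Qed.

End Null.

(** * Internal functions *)

Section Internal.
Variables (R : realType) (J : finType) (T : nat -> finType).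

(** A sequence of functions on the spaces [T N ^ J], thought of as one function on
    their ultraproduct. *)
Definition ifun := forall N, {ffun J -> T N} -> R.

Implicit Types (e g : {set J}) (d : nat) (h : ifun).

Definition idep e h := forall N, dep e (h N).
Definition unital h := forall N x, 0 <= h N x <= 1.
(** The sets of coordinates that level [d] allows inside [e]; level 1 consists of
    the empty set, hence of the constants. *)
Definition low e d : pred {set J} := fun g => (g \subset e) && (#|g| < d)%N.

(** The functions measurable for boundedly many internal sets of fewer than [d]
    coordinates out of [e]: the number of colours does not depend on [N], while
    the value [Phi N] attached to a colour pattern may. *)
Definition simple e d h := exists (C : finType)
    (c : forall g N, {ffun J -> T N} -> C) (Phi : nat -> ({set J} -> C) -> R),
  [/\ forall g N, dep g (c g N),
      forall N gam, 0 <= Phi N gam <= 1,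
      forall N gam gam', (forall g, low e d g -> gam g = gam' g) ->
        Phi N gam = Phi N gam' &
      forall N x, h N x = Phi N (fun g => c g N x)].

Lemma simple_unital e d h : simple e d h -> unital h.
Proof. by case=> C [c [Phi [_ Phi01 _ hE]]] N x; rewrite hE. Qed.

Lemma simple_idep e d h : simple e d h -> idep e h.
Proof.
case=> C [c [Phi [cdep _ Phidep hE]]] N x y xy; rewrite !hE.
apply: Phidep => g /andP[ge _]; apply: cdep => k kg.
by apply: xy; apply: fintype.subsetP kg.
Qed.

Lemma simple_color e d (C : finType) (g : {set J})
    (c : forall N, {ffun J -> T N} -> C) (phi : nat -> C -> R) :
  (forall N, dep g (c N)) -> (forall N a, 0 <= phi N a <= 1) -> low e d g ->
  simple e d (fun N x => phi N (c N x)).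
Proof.
move=> cdep phi01 gl.
exists (option C), (fun g' N x => if g' == g then Some (c N x) else None).
exists (fun N gam => if gam g is Some a then phi N a else 0); split.
- by move=> g' N x y xy; case: eqP => // g'g; rewrite (cdep N x y)// -g'g.
- by move=> N gam; case: (gam g) => [a|]; rewrite ?lexx ?ler01.
- by move=> N gam gam' /(_ _ gl) ->.
- by move=> N x; rewrite eqxx.
Qed.

Lemma simple_cst e d (a : nat -> R) : (forall N, 0 <= a N <= 1) ->
  simple e d (fun N _ => a N).
Proof.
by move=> a01; exists unit, (fun _ _ _ => tt), (fun N _ => a N); split.
Qed.

Lemma simple_op2 e d h1 h2 (Th : nat -> R -> R -> R) :
  (forall N a b, 0 <= a <= 1 -> 0 <= b <= 1 -> 0 <= Th N a b <= 1) ->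
  simple e d h1 -> simple e d h2 -> simple e d (fun N x => Th N (h1 N x) (h2 N x)).
Proof.
move=> Th01 [C1 [c1 [P1 [D1 B1 L1 H1]]]] [C2 [c2 [P2 [D2 B2 L2 H2]]]].
exists (C1 * C2)%type, (fun g N x => (c1 g N x, c2 g N x)).
exists (fun N gam => Th N (P1 N (fun g => (gam g).1)) (P2 N (fun g => (gam g).2))).
split.
- by move=> g N x y xy; rewrite (D1 g N x y)// (D2 g N x y).
- by move=> N gam; apply: Th01.
- by move=> N gam gam' H; congr Th; [apply: L1|apply: L2] => g /H ->.
- by move=> N x; rewrite H1 H2.
Qed.

Lemma simple_op1 e d h (Th : nat -> R -> R) :
  (forall N a, 0 <= a <= 1 -> 0 <= Th N a <= 1) ->
  simple e d h -> simple e d (fun N x => Th N (h N x)).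
Proof.
move=> Th01 sh; apply: (simple_op2 (Th := fun N a _ => Th N a)) (sh) (sh).
by move=> N a b /Th01.
Qed.

Lemma simpleM e d h1 h2 : simple e d h1 -> simple e d h2 ->
  simple e d (fun N x => h1 N x * h2 N x).
Proof.
apply: (simple_op2 (Th := fun _ a b => a * b)) => _ a b /andP[a0 a1] /andP[b0 b1].
by rewrite mulr_ge0//= mulr_ile1.
Qed.

Lemma simple_compl e d h : simple e d h -> simple e d (fun N x => 1 - h N x).
Proof. by apply: (simple_op1 (Th := fun _ a => 1 - a)) => _ a; lra. Qed.

Lemma simple_prod e d (I : finType) (P : pred I) (F : I -> ifun) :
  (forall i, P i -> simple e d (F i)) ->
  simple e d (fun N x => \prod_(i | P i) F i N x).
Proof.
move=> sF; suff : forall s : seq I,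
    simple e d (fun N x => \prod_(i <- s | P i) F i N x) by apply.
elim=> [|i s IH].
  have -> : (fun N x => \prod_(i <- [::] | P i) F i N x) = (fun _ _ => 1) :> ifun.
    by apply: functional_extensionality_dep => N; apply/funext => x; rewrite big_nil.
  by apply: simple_cst => _; rewrite ler01 lexx.
have [Pi|Pi] := boolP (P i).
  have -> : (fun N x => \prod_(i <- i :: s | P i) F i N x) =
      (fun N x => F i N x * \prod_(i <- s | P i) F i N x) :> ifun.
    by apply: functional_extensionality_dep => N; apply/funext => x; rewrite big_cons Pi.
  exact: simpleM (sF _ Pi) IH.
have -> // : (fun N x => \prod_(i <- i :: s | P i) F i N x) =
    (fun N x => \prod_(i <- s | P i) F i N x) :> ifun.
by apply: functional_extensionality_dep => N; apply/funext => x; rewrite big_cons (negbTE Pi).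
Qed.

Lemma low_sub e e' d d' g : e \subset e' -> (d <= d')%N -> low e d g -> low e' d' g.
Proof.
by move=> ee dd /andP[ge gd]; rewrite /low (fintype.subset_trans ge ee) (leq_trans gd dd).
Qed.

Lemma simple_sub e e' d d' h : e \subset e' -> (d <= d')%N ->
  simple e d h -> simple e' d' h.
Proof.
move=> ee dd [C [c [Phi [cdep Phi01 Phidep hE]]]].
exists C, c, Phi; split=> // N gam gam' H; apply: Phidep => g gl; apply: H.
exact: low_sub gl.
Qed.

(** Simple functions attached to different sets of coordinates can be read off
    one colouring. *)
Lemma simple_joint (I : finType) (e : I -> {set J}) d (S : I -> ifun) :
  (forall i, simple (e i) d (S i)) ->
  exists (C : finType) (c : forall g N, {ffun J -> T N} -> C)
    (Phi : I -> nat -> ({set J} -> C) -> R),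
  [/\ forall g N, dep g (c g N),
      forall i N gam, 0 <= Phi i N gam <= 1,
      forall i N gam gam', (forall g, low (e i) d g -> gam g = gam' g) ->
        Phi i N gam = Phi i N gam' &
      forall i N x, S i N x = Phi i N (fun g => c g N x)].
Proof.
move=> sS; pose wC i := cid (sS i); pose C i := sval (wC i).
pose wc i := cid (svalP (wC i)); pose c i := sval (wc i).
pose wPhi i := cid (svalP (wc i)); pose Phi i := sval (wPhi i).
have H i := svalP (wPhi i).
exists {dffun forall i : I, C i}.
exists (fun g N x => [ffun i => c i g N x]).
exists (fun i N (gam : {set J} -> {dffun forall i : I, C i}) =>
  Phi i N (fun g => gam g i)); split.
- move=> g N x y xy; apply/ffunP => i; rewrite !ffunE.
  by have [D _ _ _] := H i; exact: (D g N x y xy).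
- by move=> i N gam; have [_ B _ _] := H i; apply: B.
- by move=> i N gam gam' gg; have [_ _ L _] := H i; apply: L => g /gg ->.
- move=> i N x; have [_ _ L E] := H i; rewrite E; apply: L => g _.
  by rewrite ffunE.
Qed.

End Internal.

(** * Projections onto the simple functions *)

Lemma near_all (I : finType) (U : set_system nat) {FU : Filter U}
    (P : I -> nat -> Prop) :
  (forall i, \forall N \near U, P i N) -> \forall N \near U, forall i, P i N.
Proof.
move=> H; suff : forall s : seq I, \forall N \near U, {in s, forall i, P i N}.
  move=> /(_ (enum I)); apply: filterS => N HN i; apply: HN.
  by rewrite mem_enum.
elim=> [|i s IH]; first by apply: nearW.
apply: filterS2 (H i) IH => N Pi Ps j; rewrite inE => /predU1P[->//|].
exact: Ps.
Qed.

Lemma clip_unital (R : realType) (a : R) : 0 <= Num.min 1 (Num.max 0 a) <= 1.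
Proof. by rewrite le_min ler01 le_max lexx ge_min lexx. Qed.

Lemma ler_abs_amgm (R : realType) (z t : R) : 0 < t ->
  `|z| <= (z ^+ 2 / t + t) / 2.
Proof.
move=> t0; have -> : (z ^+ 2 / t + t) / 2 = (`|z| ^+ 2 + t ^+ 2) / (2 * t).
  by rewrite (real_normK (num_real z)); field; rewrite gt_eqF.
by rewrite ler_pdivlMr ?mulr_gt0//; have := sqr_ge0 (`|z| - t); nra.
Qed.

(** Truncating [w = h + t * u] to the unit interval decreases [2 * f * w - w ^+ 2]
    by at most the excess of the majorant [nu] over 1, tested against the bounded
    function [s]: this is what keeps the projection of an unbounded function
    inside the unit interval. *)
Lemma clip_gain (R : realType) (f nu h u t : R) :
  0 <= f <= nu -> 0 <= u <= 1 ->
  let v := Num.min 1 (Num.max 0 (h + t * u)) in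
  let s := Num.min 1 (Num.max 0 (h + t * u - 1)) in
  h + t * u <= 2 ->
  (2 * f * h - h ^+ 2) + 2 * t * ((f - h) * u) - t ^+ 2 - 2 * ((nu - 1) * s) <=
  2 * f * v - v ^+ 2.
Proof.
move=> /andP[f0 fnu] /andP[u0 u1] v s; rewrite {}/v {}/s => w2.
have -> : 2 * f * h - h ^+ 2 + 2 * t * ((f - h) * u) - t ^+ 2 =
  2 * f * (h + t * u) - (h + t * u) ^+ 2 + t ^+ 2 * (u ^+ 2 - 1) by ring.
have tu : t ^+ 2 * (u ^+ 2 - 1) <= 0.
  by rewrite mulr_ge0_le0 ?sqr_ge0// subr_le0 expr_le1.
move: (h + t * u) w2 => w w2.
have [w1|w1] := leP w 1; last first.
  rewrite (@max_r _ _ 0 w) ?(@max_r _ _ 0 (w - 1)); try lra.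
  rewrite (@min_l _ _ 1 w) ?(@min_r _ _ 1 (w - 1)); try lra.
  by nra.
rewrite (@max_l _ _ 0 (w - 1)) ?subr_le0// (@min_r _ _ 1 0)//.
have [w0|w0] := leP 0 w; first by rewrite min_r//; lra.
by rewrite min_r//; nra.
Qed.

Section Closure.
Variables (R : realType) (J : finType) (T : nat -> finType) (U : set_system nat).
Context {FU : UltraFilter U}.
Hypothesis U_oo : forall n, \forall N \near U, (n <= N)%N.
Hypothesis X_gt0 : forall N, (0 < #|{ffun J -> T N}|)%N.

Implicit Types (e g : {set J}) (d : nat) (h : ifun R J T).

(** The closure of the simple functions for the L1 seminorm of the ultraproduct. *)
Definition lsimple e d h := forall eps, 0 < eps -> exists2 h', simple e d h' &
  \forall N \near U, mean (fun x => `|h N x - h' N x|) <= eps.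

Section Projection.
Variables (e : {set J}) (d : nat) (f nu : ifun R J T).
Arguments f : clear implicits.
Arguments nu : clear implicits.
Hypothesis f_bound : forall N x, 0 <= f N x <= nu N x.
Hypothesis nu_one : forall h, simple e d h ->
  nul U (fun N => mean (fun x => (nu N x - 1) * h N x)).

(* Minus the squared distance to f, without the mean of f ^+ 2, which the
   hypotheses do not bound. *)
Let q h N := mean (fun x => 2 * f N x * h N x - h N x ^+ 2).

Let q_le3 h : simple e d h -> \forall N \near U, q h N <= 3.
Proof.
move=> sh; apply: filterS (nu_one sh ltr01) => N nuN.
have -> : 3 = 2 * 1 + 1 :> R by ring.
rewrite (@le_trans _ _ (2 * mean (fun x => (nu N x - 1) * h N x) + 1))//; last first.
  by rewrite lerD2r ler_pM2l// (le_trans _ nuN)// ler_norm.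
rewrite -[X in _ + X](mean_cst _ (X_gt0 N)) -meanZ -meanD; apply: ler_mean => x.
have /andP[h0 h1] := simple_unital sh x; have /andP[f0 fnu] := f_bound x.
by have := sqr_ge0 (h N x - 1); nra.
Qed.

Let A : set R := [set a | exists2 h, simple e d h & \forall N \near U, a <= q h N]%classic.

Let A_sup : has_sup A.
Proof.
split.
  exists 0, (fun _ _ => 0); first by apply: simple_cst => _; rewrite lexx ler01.
  apply: nearW => N; apply: mean_ge0 => x; by rewrite mulr0 expr0n subr0.
exists 3 => a [h sh ah].
by have [N [aN qN]] := filter_ex (filterI ah (q_le3 sh)); apply: le_trans qN.
Qed.

Let q_le_sup h delta : simple e d h -> 0 < delta ->
  \forall N \near U, q h N <= sup A + delta.
Proof.
move=> sh d0; have [//|UA] := in_ultra_setVsetC [set N | q h N <= sup A + delta]%classic FU.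
suff : A (sup A + delta).
  by move=> /(ub_le_sup A_sup.2); rewrite gerDl leNgt d0.
exists h => //; apply: filterS UA => N /= /negP; rewrite -ltNge; exact: ltW.
Qed.

Let tau (m : nat) : R := m.+1%:R^-1.
Let tau_gt0 m : 0 < tau m. Proof. by rewrite invr_gt0. Qed.
Let tau_le1 m : tau m <= 1. Proof. by rewrite invf_le1// ler1n. Qed.
Let tau_mono m n : (m <= n)%N -> tau n <= tau m.
Proof. by move=> mn; rewrite lef_pV2 ?posrE// ler_nat ltnS. Qed.

Let maximizing : exists h : nat -> ifun R J T, forall m, simple e d (h m) /\
  \forall N \near U, sup A - tau m ^+ 2 <= q (h m) N.
Proof.
suff : forall m, exists h, simple e d h /\
    \forall N \near U, sup A - tau m ^+ 2 <= q h N by move=> /choice[h H]; exists h.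
move=> m; have t0 : 0 < tau m ^+ 2 by rewrite exprn_gt0.
have [a [h sh ah] aS] := sup_adherent t0 A_sup.
by exists h; split=> //; apply: filterS ah => N; apply: le_trans; apply: ltW.
Qed.

(* Variation of a near maximizer in the directions u and - u. *)
Let maximizing_orth h m u : simple e d h ->
  (\forall N \near U, sup A - tau m ^+ 2 <= q h N) -> simple e d u ->
  \forall N \near U, `|mean (fun x => (f N x - h N x) * u N x)| <= 3 * tau m.
Proof.
move=> sh hmax su.
suff H t : `|t| = tau m -> \forall N \near U,
    2 * t * mean (fun x => (f N x - h N x) * u N x) <= 5 * tau m ^+ 2.
  have Hp : `|tau m| = tau m by rewrite ger0_norm// ltW.
  have Hn : `|- tau m| = tau m by rewrite normrN.
  apply: filterS2 (H _ Hp) (H _ Hn) => N; move: (mean _) (tau_gt0 m) => W t0 H1 H2.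
  rewrite ler_norml; apply/andP; split.
    by rewrite -(ler_pM2l t0); nra.
  by rewrite -(ler_pM2l t0); nra.
move=> tE.
pose v : ifun R J T := fun N x => Num.min 1 (Num.max 0 (h N x + t * u N x)).
pose s : ifun R J T := fun N x => Num.min 1 (Num.max 0 (h N x + t * u N x - 1)).
have sv : simple e d v.
  by apply: (simple_op2 (Th := fun _ a b => Num.min 1 (Num.max 0 (a + t * b)))) (sh) (su)
    => _ a b _ _; exact: clip_unital.
have ss : simple e d s.
  by apply: (simple_op2 (Th := fun _ a b => Num.min 1 (Num.max 0 (a + t * b - 1))))
    (sh) (su) => _ a b _ _; exact: clip_unital.
have t2 : 0 < tau m ^+ 2 by rewrite exprn_gt0.
apply: filterS3 hmax (q_le_sup sv t2) (nu_one ss t2) => N hN vN.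
move=> /(le_trans (ler_norm _)) sN.
have tt : t ^+ 2 = tau m ^+ 2 by rewrite -tE real_normK// num_real.
suff : q h N + 2 * t * mean (fun x => (f N x - h N x) * u N x) - t ^+ 2
    - 2 * mean (fun x => (nu N x - 1) * s N x) <= q v N.
  by rewrite tt; lra.
rewrite -[t ^+ 2](mean_cst _ (X_gt0 N)) -!meanZ -meanD -!meanB.
apply: ler_mean => x; apply: clip_gain; first exact: f_bound.
  exact: simple_unital su _ _.
have /andP[_ h1] := simple_unital sh x; have /andP[u0 u1] := simple_unital su x.
have : `|t| <= 1 by rewrite tE.
by rewrite ler_norml; nra.
Qed.

(* By concavity the midpoint of two near maximizers beats them by a quarter of
   their squared distance. *)
Let maximizing_cauchy h h' m n : (m <= n)%N -> simple e d h -> simple e d h' ->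
  (\forall N \near U, sup A - tau m ^+ 2 <= q h N) ->
  (\forall N \near U, sup A - tau n ^+ 2 <= q h' N) ->
  \forall N \near U, mean (fun x => `|h N x - h' N x|) <= 5 * tau m.
Proof.
move=> mn sh sh' hmax hmax'.
pose v : ifun R J T := fun N x => (h N x + h' N x) / 2.
have sv : simple e d v.
  apply: (simple_op2 (Th := fun _ a b => (a + b) / 2)) (sh) (sh') => _ a b; lra.
have t2 : 0 < tau m ^+ 2 by rewrite exprn_gt0.
apply: filterS3 hmax hmax' (q_le_sup sv t2) => N hN hN' vN.
have tmn : tau n ^+ 2 <= tau m ^+ 2 by apply: lerXn2r; rewrite ?nnegrE ?tau_mono// ltW.
have t0 := tau_gt0 m.
rewrite (@le_trans _ _ (mean (fun x => ((h N x - h' N x) ^+ 2 / tau m + tau m) / 2)))//.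
  by apply: ler_mean => x; exact: ler_abs_amgm.
rewrite meanZr meanD meanZr mean_cst//.
have -> : mean (fun x => (h N x - h' N x) ^+ 2) = 4 * q v N - 2 * q h N - 2 * q h' N.
  by rewrite -!meanZ -!meanB; apply: eq_mean => x; rewrite /v; field.
rewrite ler_pdivrMr// -lerBrDr ler_pdivrMr//; nra.
Qed.

(** The maximizers of [q] form a Cauchy sequence for the L1 distance; following
    the [m]-th of them with [m] growing slowly enough along [N] gives an
    internal function that is a limit of all of them, which replaces
    completeness. *)
Theorem projection : exists g : ifun R J T, [/\ (forall N, exists2 h, simple e d h & g N = h N),
  lsimple e d g &
  forall h, simple e d h -> nul U (fun N => mean (fun x => (f N x - g N x) * h N x))].
Proof.
have [h hP] := maximizing.
pose close m n N := mean (fun x => `|h m N x - h n N x|) <= 5 * tau m.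
pose P n N := forall m n' : 'I_n.+1, (m <= n')%N -> close m n' N.
have PU n : \forall N \near U, P n N.
  apply: near_all => m; apply: near_all => n'.
  have [mn|mn] := leqP m n'; last by apply: nearW.
  have [[s1 m1] [s2 m2]] := (hP m, hP n').
  by apply: filterS (maximizing_cauchy mn s1 s2 m1 m2) => N.
have P0 N : P 0%N N.
  move=> m n' _; rewrite !ord1 /close.
  by under eq_mean do rewrite subrr normr0; rewrite mean_cst// mulr_ge0// ltW.
(* The largest index up to N whose Cauchy estimates all hold at N. *)
pose k N := (\max_(n < N.+1 | `[< P n N >]) n)%N.
have kP N : P (k N) N.
  apply: (big_ind (fun n => P n N)) => // [a b Pa Pb|i /asboolP//].
  by rewrite /maxn; case: ifP.
have kU n : \forall N \near U, close n (k N) N.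
  apply: filterS2 (PU n) (U_oo n) => N Pn nN.
  have nk : (n <= k N)%N.
    rewrite /k -[n]/(val (Ordinal (nN : (n < N.+1)%N))).
    by apply: leq_bigmax_cond; apply/asboolP.
  exact: (kP N (Ordinal (nk : (n < (k N).+1)%N)) ord_max nk).
have tau_small eps : 0 < eps -> exists m, 10 * tau m <= eps.
  move=> e0; have e1 : 0 < eps / 10 by rewrite divr_gt0.
  have [m _ mP] := near_infty_natSinv_lt (PosNum e1).
  exists m; have := mP m (leqnn m); rewrite /= -/(tau m) ltr_pdivlMr// => /ltW.
  by rewrite mulrC.
exists (fun N => h (k N) N); split.
- by move=> N; exists (h (k N)) => //; exact: (hP (k N)).1.
- move=> eps e0; have [m tm] := tau_small eps e0.
  exists (h m); first exact: (hP m).1.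
  apply: filterS (kU m) => N cN.
  under eq_mean do rewrite distrC.
  by rewrite (le_trans cN)// (le_trans _ tm)// ler_pM2r// ler_nat.
- move=> u su eps e0; have [m tm] := tau_small eps e0.
  have [sm mm] := hP m.
  apply: filterS2 (kU m) (maximizing_orth sm mm su) => N cN oN.
  rewrite (le_trans _ tm)//.
  have -> : mean (fun x => (f N x - h (k N) N x) * u N x) =
     mean (fun x => (f N x - h m N x) * u N x) +
     mean (fun x => (h m N x - h (k N) N x) * u N x).
    by rewrite -meanD; apply: eq_mean => x; ring.
  rewrite (le_trans (ler_normD _ _))// (@le_trans _ _ (3 * tau m + 5 * tau m))//.
    rewrite lerD// (le_trans (ler_norm_mean _))// (le_trans _ cN)//.
    apply: ler_mean => x; have /andP[u0 u1] := simple_unital su x.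
    by rewrite normrM ler_piMr// ger0_norm.
  by rewrite -mulrDl ler_pM2r// -natrD ler_nat.
Qed.

End Projection.
End Closure.

(** * Measurable internal functions and orthogonality *)

Lemma prod_unital (R : realType) (I : Type) (s : seq I) (P : pred I) (a : I -> R) :
  (forall i, P i -> 0 <= a i <= 1) -> 0 <= \prod_(i <- s | P i) a i <= 1.
Proof.
move=> a01; elim/big_ind: _ => [|x y /andP[x0 x1] /andP[y0 y1]|//].
  by rewrite ler01 lexx.
by rewrite mulr_ge0//= mulr_ile1.
Qed.

Lemma ler_dist_prod (R : realType) (I : Type) (s : seq I) (P : pred I) (a b : I -> R) :
  (forall i, P i -> 0 <= a i <= 1) -> (forall i, P i -> 0 <= b i <= 1) ->
  `|\prod_(i <- s | P i) a i - \prod_(i <- s | P i) b i| <=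
  \sum_(i <- s | P i) `|a i - b i|.
Proof.
move=> a01 b01; elim: s => [|i s IH]; first by rewrite !big_nil subrr normr0.
rewrite !big_cons; case: ifP => // Pi.
have /andP[p0 p1] := prod_unital s a01; have /andP[r0 r1] := b01 _ Pi.
move: IH; move: (\prod_(j <- s | P j) a j) p0 p1 => p p0 p1.
move: (\prod_(j <- s | P j) b j) => q IH.
have -> : a i * p - b i * q = p * (a i - b i) + b i * (p - q) by ring.
rewrite (le_trans (ler_normD _ _))// !normrM lerD//.
  by rewrite ler_piMl// ger0_norm.
by rewrite (le_trans _ IH)// ler_piMl// ger0_norm.
Qed.

Lemma quantize (R : realType) (J : finType) (T : nat -> finType) (e : {set J}) d
    (g : {set J}) (w : ifun R J T) (eps : R) :
  0 < eps -> unital w -> idep g w -> low e d g ->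
  exists2 w', simple e d w' & forall N x, `|w N x - w' N x| <= eps.
Proof.
move=> e0 w01 wg gl.
have [n _ nP] := near_infty_natSinv_lt (PosNum e0).
have {nP} := nP n (leqnn n); rewrite /= => nP.
pose c N x : 'I_n.+2 := inord (Num.truncn (n.+1%:R * w N x)).
exists (fun N x => (c N x)%:R / n.+1%:R).
  apply: (simple_color (phi := fun _ (a : 'I_n.+2) => a%:R / n.+1%:R)) (gl).
    by move=> N x y /wg xy; rewrite /c xy.
  by move=> _ a; rewrite divr_ge0//= ler_pdivrMr ?ltr0n// mul1r ler_nat -ltnS.
move=> N x; have /andP[w0 w1] := w01 N x.
have z0 : 0 <= n.+1%:R * w N x by rewrite mulr_ge0.
have z1 : n.+1%:R * w N x <= n.+1%:R by rewrite ler_piMr.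
have /andP[t0 t1] := truncn_itv z0.
rewrite /c inordK; last first.
  by rewrite ltnS -(ler_nat R) (le_trans t0).
rewrite (le_trans _ (ltW nP))//.
have n0 : (0 : R) < n.+1%:R by rewrite ltr0n.
move: (Num.truncn _) t0 t1 => k; rewrite -[k.+1%:R]natr1 => t0 t1.
have -> : w N x - k%:R / n.+1%:R = (n.+1%:R * w N x - k%:R) / n.+1%:R.
  by field; rewrite addrC natr1 gt_eqF.
rewrite ger0_norm; last by rewrite divr_ge0// subr_ge0.
rewrite ler_pdivrMr// mulVf ?gt_eqF//.
by rewrite lerBlDl ltW.
Qed.

Section Measurable.
Variables (R : realType) (J : finType) (T : nat -> finType) (U : set_system nat).
Context {FU : UltraFilter U}.
Hypothesis U_oo : forall n, \forall N \near U, (n <= N)%N.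
Hypothesis X_gt0 : forall N, (0 < #|{ffun J -> T N}|)%N.

Implicit Types (e g : {set J}) (d : nat) (h u w : ifun R J T).

Definition meas e d h := [/\ idep e h, unital h & lsimple U e d h].

Lemma simple_meas e d h : simple e d h -> meas e d h.
Proof.
move=> sh; split; [exact: simple_idep sh|exact: simple_unital sh|].
move=> eps e0; exists h => //; apply: nearW => N.
by under eq_mean do rewrite subrr normr0; rewrite mean_cst// ltW.
Qed.

Lemma meas_sub e e' d d' h : e \subset e' -> (d <= d')%N ->
  meas e d h -> meas e' d' h.
Proof.
move=> ee dd [hd h01 hl]; split => //.
  by move=> N; apply: dep_sub ee _; exact: hd.
by move=> eps /hl[h' sh' H]; exists h' => //; apply: simple_sub sh'.
Qed.

(** The operation is applied to simple approximations; the Lipschitz bound controls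
    the error in L1. *)
Lemma meas_op2 (L : R) (Th : R -> R -> R) e d h1 h2 :
  (forall a b, 0 <= a <= 1 -> 0 <= b <= 1 -> 0 <= Th a b <= 1) ->
  (forall a b a' b', 0 <= a <= 1 -> 0 <= b <= 1 -> 0 <= a' <= 1 -> 0 <= b' <= 1 ->
    `|Th a b - Th a' b'| <= L * (`|a - a'| + `|b - b'|)) ->
  meas e d h1 -> meas e d h2 -> meas e d (fun N x => Th (h1 N x) (h2 N x)).
Proof.
move=> Th01 ThL [d1 u1 l1] [d2 u2 l2]; split.
- by move=> N x y xy; rewrite (d1 N x y)// (d2 N x y).
- by move=> N x; apply: Th01.
move=> eps e0; have L0 : 0 < `|L| + 1 by rewrite ltr_wpDl.
have e2 : 0 < eps / (`|L| + 1) / 2 by rewrite !divr_gt0.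
have [h1' s1 a1] := l1 _ e2; have [h2' s2 a2] := l2 _ e2.
exists (fun N x => Th (h1' N x) (h2' N x)).
  by apply: (simple_op2 (Th := fun _ => Th)).
apply: filterS2 a1 a2 => N a1 a2.
rewrite (@le_trans _ _ ((`|L| + 1) *
  (mean (fun x => `|h1 N x - h1' N x|) + mean (fun x => `|h2 N x - h2' N x|))))//.
  rewrite -meanD -meanZ; apply: ler_mean => x.
  rewrite (le_trans (ThL _ _ _ _ (u1 N x) (u2 N x)
    (simple_unital s1 x) (simple_unital s2 x)))//.
  by rewrite ler_wpM2r ?addr_ge0// (le_trans (ler_norm L))// lerDl.
by rewrite mulrC -ler_pdivlMr// [leRHS]splitr lerD.
Qed.

Lemma measM e d h1 h2 : meas e d h1 -> meas e d h2 ->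
  meas e d (fun N x => h1 N x * h2 N x).
Proof.
apply: (@meas_op2 1 (fun a b => a * b)).
  by move=> a b /andP[a0 a1] /andP[b0 b1]; rewrite mulr_ge0//= mulr_ile1.
move=> a b a' b' /andP[a0 a1] /andP[b0 b1] /andP[a'0 a'1] /andP[b'0 b'1].
have -> : a * b - a' * b' = b * (a - a') + a' * (b - b') by ring.
rewrite mul1r (le_trans (ler_normD _ _))// !normrM lerD//.
  by rewrite ler_piMl// ger0_norm.
by rewrite ler_piMl// ger0_norm.
Qed.

Lemma meas_cst e d (a : R) : 0 <= a <= 1 -> meas e d (fun _ _ => a).
Proof. by move=> a01; apply/simple_meas/simple_cst. Qed.

Lemma meas_prod e d (I : Type) (s : seq I) (P : pred I) (F : I -> ifun R J T) :
  (forall i, P i -> meas e d (F i)) ->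
  meas e d (fun N x => \prod_(i <- s | P i) F i N x).
Proof.
move=> mF; elim: s => [|i s IH].
  have -> : (fun N x => \prod_(i <- [::] | P i) F i N x) = (fun _ _ => 1) :> ifun R J T.
    by apply: functional_extensionality_dep => N; apply/funext => x; rewrite big_nil.
  by apply: meas_cst; rewrite ler01 lexx.
have [Pi|Pi] := boolP (P i).
  have -> : (fun N x => \prod_(i <- i :: s | P i) F i N x) =
      (fun N x => F i N x * \prod_(i <- s | P i) F i N x) :> ifun R J T.
    by apply: functional_extensionality_dep => N; apply/funext => x; rewrite big_cons Pi.
  exact: measM (mF _ Pi) IH.
have -> // : (fun N x => \prod_(i <- i :: s | P i) F i N x) =
    (fun N x => \prod_(i <- s | P i) F i N x) :> ifun R J T.
by apply: functional_extensionality_dep => N; apply/funext => x; rewrite big_cons (negbTE Pi).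
Qed.

(** Negligible correlation with everything visible at level [d] inside [e]. *)
Definition orth e d u := forall h, simple e d h ->
  nul U (fun N => mean (fun x => u N x * h N x)).

(** The function [g] is the conditional expectation of [f] on the algebra of level
    [d]. The majorant may be unbounded: as it looks like 1 to that algebra, [g] is
    a bounded, dense model of [f]. *)
Theorem conditional_expectation e d (f nu : ifun R J T) :
  (forall N x, 0 <= f N x <= nu N x) -> orth e d (fun N x => nu N x - 1) ->
  exists2 g, meas e d g & orth e d (fun N x => f N x - g N x).
Proof.
move=> fnu nu1; have [g [gN gl gorth]] := projection U_oo X_gt0 fnu nu1.
exists g => //; split=> // [N|N x]; have [h sh ->] := gN N.
  exact: simple_idep sh N.
exact: simple_unital sh _ _.
Qed.

Lemma orth0 e d : orth e d (fun _ _ => 0).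
Proof.
move=> h _; apply: (eq_nul _ (@nul0 R U _)) => N.
by under eq_mean do rewrite mul0r; rewrite mean_cst.
Qed.

Corollary conditional_expectation1 e d f : unital f ->
  exists2 g, meas e d g & orth e d (fun N x => f N x - g N x).
Proof.
move=> f01; apply: (conditional_expectation (nu := fun _ _ => 1)) => //.
by move=> h /orth0; apply: eq_nul => N; apply: eq_mean => x; rewrite subrr.
Qed.

(** A simple function remains simple when coordinates are fixed, since a set of
    fewer than [d] coordinates meets [e] in fewer than [d] coordinates. *)
Lemma simple_splice e d h (y : forall N, {ffun J -> T N}) :
  simple finset.setT d h -> simple e d (fun N x => h N (splice e x (y N))).
Proof.
case=> C [c [Phi [cdep Phi01 Phidep hE]]].
exists {ffun {set J} -> C}, (fun g' N x => [ffun g => c g N (splice g' x (y N))]).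
exists (fun N (gam : {set J} -> {ffun {set J} -> C}) =>
  Phi N (fun g => gam (g :&: e)%SET g)); split => //.
- move=> g' N x x' xx'; apply/ffunP => g; rewrite !ffunE; congr c.
  by apply/ffunP => k; rewrite !ffunE; case: ifP => // /xx'.
- move=> N gam gam' H; apply: Phidep => g /andP[_ gd]; rewrite H//.
  by rewrite /low subsetIr (leq_ltn_trans _ gd)// subset_leq_card// subsetIl.
- move=> N x; rewrite hE; apply: Phidep => g _; rewrite ffunE; apply: cdep => k kg.
  by rewrite !ffunE inE kg.
Qed.

(** Testing a function of the coordinates in [e] against a product of functions
    of sets [s i] only involves the sets [s i :&: e], once the coordinates
    outside [e] are fixed at their worst values; a bounded function of fewer
    than [d] coordinates is a uniform limit of simple functions. *)
Lemma orth_prod (I : finType) (s : I -> {set J}) (w : I -> ifun R J T) e d u h (M : R) :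
  idep e u -> (\forall N \near U, mean (fun x => `|u N x|) <= M) -> orth e d u ->
  (forall i, unital (w i)) -> (forall i, idep (s i) (w i)) ->
  (forall i, (#|s i :&: e| < d)%N) -> simple finset.setT d h ->
  nul U (fun N => mean (fun x => u N x * (\prod_i w i N x * h N x))).
Proof.
move=> ud uM uo w01 wd sd sh.
pose W N x := \prod_i w i N x * h N x.
have yP N : exists y, `|mean (fun x => u N x * W N x)| <=
    `|mean (fun x => u N x * W N (splice e x y))|.
  have [y yP] := mean_le_max (fun y => `|mean (fun x => u N x * W N (splice e x y))|) (X_gt0 N).
  exists y; apply: le_trans yP; rewrite (mean_splice _ e).
  apply: (le_trans (ler_norm_mean _)); apply: ler_mean => y'.
  rewrite (@eq_mean _ _ _ (fun x => u N x * W N (splice e x y')))// => x.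
  by congr (_ * _); apply: ud => k ke; rewrite ffunE ke.
pose y N := sval (cid (yP N)).
pose w' i : ifun R J T := fun N x => w i N (splice e x (y N)).
pose h' : ifun R J T := fun N x => h N (splice e x (y N)).
have sh' : simple e d h' by exact: simple_splice.
have w'01 i : unital (w' i) by move=> N x; exact: w01.
apply: (nul_le (v := fun N => `|mean (fun x => u N x * (\prod_i w' i N x * h' N x))|)).
  by apply: nearW => N; exact: (svalP (cid (yP N))).
suff H : nul U (fun N => mean (fun x => u N x * (\prod_i w' i N x * h' N x))).
  by move=> eps e0; apply: filterS (H _ e0) => N; rewrite normr_id.
apply: (nul_approx (M := M * #|I|%:R)) => eps e0.
have qP i : exists w'', simple e d w'' /\ forall N x, `|w' i N x - w'' N x| <= eps.
  have [||w'' s'' H] := @quantize _ _ _ e d (s i :&: e)%SET (w' i) eps e0 (w'01 i).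
  - move=> N x x' xx'; apply: (wd i N) => k ks; rewrite !ffunE.
    by case: ifP => // ke; apply: xx'; rewrite inE ks.
  - by rewrite /low subsetIr sd.
  by exists w''.
have [w'' w''P] := choice qP.
exists (fun N => mean (fun x => u N x * (\prod_i w'' i N x * h' N x))).
  by apply: uo; apply: simpleM (sh'); apply: simple_prod => i _; exact: (w''P i).1.
apply: filterS uM => N uM.
rewrite -meanB (le_trans (ler_norm_mean _))// -mulrA.
apply: (@le_trans _ _ (mean (fun x => `|u N x|) * (#|I|%:R * eps))); last first.
  by rewrite ler_wpM2r// mulr_ge0// ltW.
rewrite -meanZr; apply: ler_mean => x; rewrite -mulrBr normrM ler_wpM2l//.
have /andP[h0 h1] := simple_unital sh' x.
rewrite -mulrBl normrM (@le_trans _ _ `|\prod_i w' i N x - \prod_i w'' i N x|)//.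
  by rewrite ler_piMr// ger0_norm.
apply: (le_trans (ler_dist_prod _ _ _)) => [i _|i _|].
- exact: w'01.
- exact: simple_unital (w''P i).1 _ _.
apply: (@le_trans _ _ (\sum_(i : I) eps)).
  by apply: ler_sum => i _; exact: (w''P i).2.
by rewrite sumr_const mulr_natl.
Qed.

Lemma orth_prod_meas (I : finType) (s : I -> {set J}) (w : I -> ifun R J T) e d u h :
  idep e u -> (forall N x, `|u N x| <= 1) -> orth e d u ->
  (forall i, unital (w i)) -> (forall i, idep (s i) (w i)) ->
  (forall i, (#|s i :&: e| < d)%N) -> meas finset.setT d h ->
  nul U (fun N => mean (fun x => u N x * (\prod_i w i N x * h N x))).
Proof.
move=> ud u1 uo w01 wd sd [_ h01 hl].
apply: (nul_approx (M := 1)) => eps e0; have [h' sh' hh'] := hl _ e0.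
exists (fun N => mean (fun x => u N x * (\prod_i w i N x * h' N x))).
  apply: (@orth_prod I s w e d u h' 1) => //; apply: nearW => N.
  by apply: mean_le_cst.
apply: filterS hh' => N; rewrite mul1r; apply: le_trans.
rewrite -meanB (le_trans (ler_norm_mean _))//; apply: ler_mean => x.
rewrite -mulrBr -mulrBr normrM normrM mulrA ler_piMl// mulr_ile1//.
have /andP[p0 p1] := prod_unital (index_enum I) (fun i (_ : true) => w01 i N x).
by rewrite ger0_norm.
Qed.

End Measurable.

(** * Removal for measurable functions *)

Lemma card_setI_lt (J : finType) (g g' : {set J}) d : g' != g ->
  (#|g| <= d)%N -> (#|g'| <= d)%N -> (#|g' :&: g| < d)%N.
Proof.
move=> gg gd g'd; rewrite ltnNge; apply: contra gg => dI.
rewrite finset.eqEsubset; apply/andP; split.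
  rewrite -(eqP (_ : g' :&: g == g')%SET) ?subsetIr//.
  by rewrite eqEcard subsetIl (leq_trans g'd).
rewrite -(eqP (_ : g' :&: g == g)%SET) ?subsetIl//.
by rewrite eqEcard subsetIr (leq_trans gd).
Qed.

Lemma one_sub_prod_le (R : realType) (I : finType) (P : pred I) (a : I -> R) :
  (forall i, P i -> 0 <= a i <= 1) ->
  1 - \prod_(i | P i) a i <= \sum_(i | P i) (1 - a i).
Proof.
move=> a01; have := @ler_dist_prod R I (index_enum I) P (fun=> 1) a.
rewrite big1_eq => /(_ _ a01) H; apply: le_trans (ler_norm _) _.
apply: le_trans (H _) _ => [i _|]; first by rewrite ler01 lexx.
by apply: ler_sum => i /a01/andP[? ?]; rewrite ger0_norm; lra.
Qed.

Lemma nul_mean_sqr (R : realType) (U : set_system nat) {FU : Filter U}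
    (T : nat -> finType) (h : forall N, T N -> R) : (forall N, (0 < #|T N|)%N) ->
  nul U (fun N => mean (fun x => h N x ^+ 2)) ->
  nul U (fun N => mean (fun x => `|h N x|)).
Proof.
move=> T0 nh; apply: (nul_small (M := 1)) => eps e0 _.
have e2 : 0 < eps ^+ 2 by rewrite exprn_gt0.
apply: filterS (nh _ e2) => N /(le_trans (ler_norm _)) hN.
rewrite mul1r ger0_norm; last by apply: mean_ge0.
apply: (@le_trans _ _ (mean (fun x => (h N x ^+ 2 / eps + eps) / 2))).
  by apply: ler_mean => x; exact: ler_abs_amgm.
rewrite meanZr meanD meanZr mean_cst// ler_pdivrMr// -lerBrDr ler_pdivrMr//.
by apply: le_trans hN _; nra.
Qed.

Section Removal.
Variables (R : realType) (J : finType) (T : nat -> finType) (U : set_system nat).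
Context {FU : UltraFilter U}.
Hypothesis X_gt0 : forall N, (0 < #|{ffun J -> T N}|)%N.
Hypothesis J_gt0 : (0 < #|J|)%N.

Implicit Types (e g : {set J}) (d : nat) (h u w : ifun R J T).

Let face (j : J) : {set J} := (~: [set j])%SET.
Let kappa : R := #|J|%:R.
Let kappa_ge1 : 1 <= kappa. Proof. by rewrite ler1n. Qed.

Section Level.
Variables (d : nat) (ind p : {set J} -> ifun R J T) (At psi : J -> ifun R J T).
Arguments ind : clear implicits.
Arguments p : clear implicits.
Arguments At : clear implicits.
Arguments psi : clear implicits.
Hypothesis d_gt0 : (0 < d)%N.
(* [ind g] is the indicator of one colour of a colouring by the coordinates in
   [g], and [p g] its projection to the lower levels; [At j] is the function whose
   support is being cut down, and [psi j] the projection of its failure on the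
   atom cut out by the [ind g]. *)
Hypothesis ind01 : forall g, unital (ind g).
Hypothesis ind_dep : forall g, idep g (ind g).
Hypothesis p_meas : forall g, meas U g d (p g).
Hypothesis ind_p : forall g, orth U g d (fun N x => ind g N x - p g N x).

(** Two distinct sets of at most [d] coordinates share fewer than [d] of them, so
    each [ind g] may be replaced by its projection while all the other factors
    are tests of lower order: the indicators of a level are independent given
    the lower levels. *)
Lemma replace_by_projection e0 (F : ifun R J T) (s : pred {set J}) h :
  unital F -> idep e0 F ->
  (forall g, s g -> (#|g| <= d)%N /\ (#|g :&: e0| < d)%N) -> meas U finset.setT d h ->
  nul U (fun N => mean (fun x => F N x * (\prod_(g | s g) ind g N x * h N x)) -
                  mean (fun x => F N x * (\prod_(g | s g) p g N x * h N x))).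
Proof.
move=> F01 Fdep sP hm.
suff : forall l : seq {set J}, uniq l -> all s l -> forall h, meas U finset.setT d h ->
  nul U (fun N => mean (fun x => F N x * (\prod_(g <- l) ind g N x * h N x)) -
                  mean (fun x => F N x * (\prod_(g <- l) p g N x * h N x))).
  move=> /(_ (enum s) (enum_uniq s) _ h hm) H; have {}H := H _.
  apply: (eq_nul _ (H _)) => [N|].
    by congr (_ - _); apply: eq_mean => x; rewrite big_enum.
  by apply/allP => g; rewrite mem_enum.
elim=> [_ _ h' _|g l IH /= /andP[gl ul] /andP[sg sl] h' h'm].
  by apply: (eq_nul _ (@nul0 R U _)) => N; under eq_mean do rewrite big_nil;
     under [in X in _ - X]eq_mean do rewrite big_nil; rewrite subrr.
have ph : meas U finset.setT d (fun N x => p g N x * h' N x).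
  by apply: measM => //; apply: meas_sub (p_meas g); rewrite ?finset.subsetT.
have [gd ge] := sP _ sg.
pose si (i : 'I_1 + {set J}) : {set J} :=
  match i with inl _ => e0 | inr g' => if g' \in l then g' else finset.set0 end.
pose wi (i : 'I_1 + {set J}) : ifun R J T :=
  match i with inl _ => F | inr g' =>
    if g' \in l then ind g' else fun _ _ => 1 end.
have H : nul U (fun N => mean (fun x => (ind g N x - p g N x) *
    (\prod_i wi i N x * h' N x))).
  apply: (@orth_prod_meas _ _ _ _ _ X_gt0 _ si wi g d _ h') => //.
  - by move=> N x y xy; rewrite (ind_dep xy); have [pd _ _] := p_meas g; rewrite (pd N x y xy).
  - move=> N x; have /andP[a0 a1] := ind01 g x.
    have [_ p01 _] := p_meas g; have /andP[b0 b1] := p01 N x.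
    by rewrite ler_norml; lra.
  - case=> [_|g'] //=; case: ifP => // _ N x; by rewrite ler01 lexx.
  - by case=> [_|g'] //=; case: ifP.
  - case=> [_|g'] /=; first by rewrite finset.setIC.
    case: ifP => [g'l|_]; last by rewrite finset.set0I cards0.
    have sg' : s g' by apply: (allP sl).
    apply: card_setI_lt => //; last exact: (sP _ sg').1.
    by apply: contraNneq gl => <-.
apply: (eq_nul _ (nulD H (IH ul sl _ ph))) => N.
rewrite -!meanB -meanD; apply: eq_mean => x.
rewrite !big_cons big_sumType big_ord1 /=.
have -> : \prod_g' wi (inr g') N x = \prod_(g' <- l) ind g' N x.
  rewrite [RHS]big_uniq// [RHS]big_mkcond; apply: eq_bigr => g' _ /=.
  by case: ifP.
ring.
Qed.

Let inside j N x := \prod_(g | low (face j) d.+1 g) ind g N x.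
Let inside_p j N x := \prod_(g | low (face j) d.+1 g) p g N x.

Arguments inside : clear implicits.
Arguments inside_p : clear implicits.

Hypothesis At01 : forall j, unital (At j).
Hypothesis At_dep : forall j, idep (face j) (At j).
Hypothesis psi_meas : forall j, meas U (face j) d (psi j).
Hypothesis psi_orth : forall j, orth U (face j) d
  (fun N x => inside j N x * (1 - At j N x) - psi j N x).

(** The part of an atom on which [At j] fails with small conditional
    probability. *)
Definition good j N x := Num.max 0 (inside_p j N x - 2 * kappa * psi j N x).
Arguments good : clear implicits.

Let p01 g : unital (p g). Proof. by have [] := p_meas g. Qed.
Let psi01 j : unital (psi j). Proof. by have [] := psi_meas j. Qed.

Let inside01 j N x : 0 <= inside j N x <= 1.
Proof. by apply: prod_unital => g _; exact: ind01. Qed.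
Let inside_p01 j N x : 0 <= inside_p j N x <= 1.
Proof. by apply: prod_unital => g _; exact: p01. Qed.

Let inside_dep j : idep (face j) (inside j).
Proof.
move=> N x y xy; apply: eq_bigr => g /andP[ge _]; apply: ind_dep => k kg.
by apply: xy; apply: fintype.subsetP kg.
Qed.

Lemma good_meas j : meas U (face j) d (good j).
Proof.
apply: (@meas_op2 _ _ _ _ _ (2 * kappa) (fun a b => Num.max 0 (a - 2 * kappa * b))) => //.
- move=> a b /andP[a0 a1] /andP[b0 b1]; rewrite le_max lexx/= ge_max ler01/=.
  have : 0 <= kappa * b by rewrite mulr_ge0.
  lra.
- move=> a b a' b' _ _ _ _.
  have maxL (x y : R) : `|Num.max 0 x - Num.max 0 y| <= `|x - y|.
    by rewrite ler_norml; case: (leP 0 x); case: (leP 0 y) => H1 H2;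
      apply/andP; split; have := ler_norm (x - y);
      have := ler_norm (- (x - y)); rewrite normrN; lra.
  rewrite (le_trans (maxL _ _))//.
  have -> : a - 2 * kappa * b - (a' - 2 * kappa * b') =
    (a - a') - 2 * kappa * (b - b') by ring.
  rewrite (le_trans (ler_normB _ _))// normrM (@ger0_norm _ (2 * kappa)); last first.
    by rewrite mulr_ge0.
  by rewrite mulrDr lerD2r ler_peMl//; move: kappa_ge1; lra.
- apply: (meas_prod X_gt0) => g /andP[ge gd]; exact: meas_sub (p_meas g).
Qed.

Let good_le j N x : good j N x <= inside_p j N x.
Proof.
have /andP[b0 b1] := psi01 j x; have /andP[i0 i1] := inside_p01 j x.
by rewrite /good ge_max i0/= gerBl !mulr_ge0.
Qed.

Let good_psi j N x : 2 * kappa * psi j N x * good j N x <= inside_p j N x * good j N x.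
Proof.
rewrite /good; have [|] := leP 0 (inside_p j N x - 2 * kappa * psi j N x).
  by move=> H; rewrite ler_wpM2r//; lra.
by rewrite !mulr0.
Qed.

Let split_face (F : {set J} -> R) j :
  \prod_(g : {set J} | (#|g| < d.+1)%N) F g =
  \prod_(g | low (face j) d.+1 g) F g *
  \prod_(g : {set J} | (#|g| < d.+1)%N && ~~ (g \subset face j)) F g.
Proof.
rewrite (bigID (fun g : {set J} => g \subset face j)) /=; congr (_ * _).
by apply: eq_bigl => g; rewrite /low andbC.
Qed.

(** Conditionally on the lower levels the atom and the failure of [At j] have
    probabilities [inside_p] and [psi]; where all [good j] are positive the
    failures fill at most half of the atom, and the rest lies in the product of
    the [At j], which is null. *)
Lemma good_null : (d.+1 <= #|J|)%N ->
  nul U (fun N => mean (fun x => \prod_j At j N x)) ->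
  nul U (fun N => mean (fun x => \prod_j good j N x)).
Proof.
move=> dJ At0.
pose h N x := \prod_j good j N x.
have hm : meas U finset.setT d h.
  apply: (meas_prod X_gt0) => j _; apply: meas_sub (good_meas j) => //.
have h01 N x : 0 <= h N x <= 1 by have [_ h01 _] := hm; exact: h01.
pose G g := (#|g| < d.+1)%N.
pose outside_pred j g := G g && ~~ (g \subset face j).
pose X N := mean (fun x => 1 * (\prod_(g | G g) p g N x * h N x)).
pose Q N := mean (fun x => 1 * (\prod_(g | G g) ind g N x * h N x)).
(* Q and X are the masses of the atom, and of its lower-level model, where all
   [good j] are positive; V j is the share of Q on which [At j] fails. *)
have QX : nul U (fun N => Q N - X N).
  apply: (@replace_by_projection finset.set0 (fun _ _ => 1)) => //.
  - by move=> N x; rewrite ler01 lexx.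
  - by move=> g gG; rewrite finset.setI0 cards0.
pose phi j N x := inside j N x * (1 - At j N x).
pose V j N := mean (fun x => phi j N x * (\prod_(g | outside_pred j g) ind g N x * h N x)).
pose V' j N := mean (fun x => phi j N x * (\prod_(g | outside_pred j g) p g N x * h N x)).
pose V'' j N := mean (fun x => psi j N x * (\prod_(g | outside_pred j g) p g N x * h N x)).
have phi01 j : unital (phi j).
  move=> N x; have /andP[a0 a1] := At01 j x; have /andP[i0 i1] := inside01 j x.
  by rewrite /phi mulr_ge0 ?subr_ge0//= mulr_ile1 ?subr_ge0//; lra.
have phi_dep j : idep (face j) (phi j).
  by move=> N x y xy; rewrite /phi (@inside_dep j N x y xy) (@At_dep j N x y xy).
have pm j : meas U finset.setT d
    (fun N x => \prod_(g | outside_pred j g) p g N x * h N x).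
  apply: measM (hm); apply: (meas_prod X_gt0) => g _; apply: meas_sub (p_meas g) => //.
have VV' j : nul U (fun N => V j N - V' j N).
  apply: (@replace_by_projection (face j)) => // g /andP[gG gf]; split => //.
  apply: leq_trans (_ : #|g| <= d)%N => //; apply: proper_card.
  by rewrite fintype.properE finset.subsetIl finset.subsetI subxx.
have VV'' j : nul U (fun N => V' j N - V'' j N).
  pose one (i : 'I_0) : ifun R J T := fun _ _ => 1.
  have H : nul U (fun N => mean (fun x => (phi j N x - psi j N x) *
      (\prod_i one i N x * (\prod_(g | outside_pred j g) p g N x * h N x)))).
    apply: (@orth_prod_meas R J T U _ X_gt0 'I_0 (fun=> finset.set0) one (face j) d) => //.
    - by move=> N x y xy; have [pd _ _] := psi_meas j; rewrite (phi_dep j N x y xy) (pd N x y xy).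
    - move=> N x; have /andP[a0 a1] := phi01 j N x; have /andP[b0 b1] := psi01 j x.
      by rewrite ler_norml; lra.
    - by move=> i N x; rewrite /one ler01 lexx.
    - by case.
  apply: (eq_nul _ H) => N; rewrite -meanB; apply: eq_mean => x.
  by rewrite big_ord0 mul1r mulrBl.
have X0 N : 0 <= X N.
  apply: mean_ge0 => x; rewrite mul1r mulr_ge0//; last by have /andP[] := h01 N x.
  by rewrite prodr_ge0// => g _; have /andP[] := p01 g x.
have V''X j N : 2 * kappa * V'' j N <= X N.
  rewrite -meanZ; apply: ler_mean => x; rewrite mul1r.
  rewrite (split_face (fun g => p g N x) j) /h (bigD1 j)//=.
  set o := \prod_(g | _) _; set b := \prod_(i | _) _.
  have o0 : 0 <= o by rewrite prodr_ge0// => g _; have /andP[] := p01 g x.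
  have b0 : 0 <= b.
    by rewrite prodr_ge0// => i _; have [_ g01 _] := good_meas i; have /andP[] := g01 N x.
  have -> : 2 * kappa * (psi j N x * (o * (good j N x * b))) =
    (o * b) * (2 * kappa * psi j N x * good j N x) by ring.
  have -> : \prod_(g | low (face j) d.+1 g) p g N x * o * (good j N x * b) =
    (o * b) * (inside_p j N x * good j N x) by rewrite /inside_p; ring.
  by rewrite ler_wpM2l ?mulr_ge0.
have QV N : Q N <= mean (fun x => \prod_j At j N x) + \sum_j V j N.
  rewrite -mean_sum -meanD; apply: ler_mean => x; rewrite mul1r.
  have i01 : 0 <= \prod_(g | G g) ind g N x <= 1.
    by apply: prod_unital => g _; exact: ind01.
  have [/andP[i0 i1] /andP[h0 h1]] := (i01, h01 N x).
  have P01 := prod_unital (index_enum J) (fun j (_ : true) => At01 j x).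
  have /andP[P0 P1] := P01.
  have -> : \sum_j phi j N x * (\prod_(g | outside_pred j g) ind g N x * h N x) =
      (\prod_(g | G g) ind g N x * h N x) * \sum_j (1 - At j N x).
    rewrite mulr_sumr; apply: eq_bigr => j _.
    by rewrite (split_face (fun g => ind g N x) j) /phi /inside; ring.
  have := one_sub_prod_le (fun j (_ : true) => At01 j x).
  move: (\prod_(g | _) _) i0 i1 (h N x) h0 h1 => a a0 a1 b b0 b1.
  move: (\prod_j _) P0 P1 (\sum_j _) => c c0 c1 s cs.
  have ab0 : 0 <= a * b by rewrite mulr_ge0.
  have ab1 : a * b <= 1 by rewrite mulr_ile1.
  move: (a * b) ab0 ab1 => z z0 z1; nra.
have Xn : nul U X.
  pose v N := (X N - Q N) + mean (fun x => \prod_j At j N x) +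
    \sum_j ((V j N - V' j N) + (V' j N - V'' j N)).
  have vn : nul U v.
    apply: nulD; last by apply: nul_sum => j _; apply: nulD.
    apply: nulD => //; apply: (eq_nul _ (nulN QX)) => N; ring.
  apply: (nul_le (v := fun N => 2 * v N)); last exact: nulZ.
  apply: nearW => N; rewrite ger0_norm//.
  have sV : \sum_j V'' j N <= X N / 2.
    apply: (@le_trans _ _ (\sum_(j : J) X N / (2 * kappa))).
      apply: ler_sum => j _; rewrite ler_pdivlMr 1?mulrC//.
      by rewrite mulr_gt0// (lt_le_trans ltr01).
    rewrite sumr_const -[_ *+ _]mulr_natr -/kappa.
    by rewrite le_eqVlt; apply/orP; left; apply/eqP; field; rewrite gt_eqF// (lt_le_trans ltr01).
  have -> : v N = X N - Q N + mean (fun x => \prod_j At j N x) + \sum_j V j N - \sum_j V'' j N.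
    rewrite /v -[RHS]addrA -sumrB; congr (_ + _).
    by apply: eq_bigr => j _; ring.
  by have := QV N; lra.
(* [good j] is at most [inside_p j], and every set of the level lies in some
   face, so that the product of the [good j] is at most the model of the atom. *)
have h2 : nul U (fun N => mean (fun x => h N x ^+ 2)).
  apply: (nul_le (v := X)) => //; apply: nearW => N.
  rewrite ger0_norm; last by apply: mean_ge0 => x; rewrite sqr_ge0.
  apply: ler_mean => x; rewrite mul1r expr2 ler_wpM2r//; first by have /andP[] := h01 N x.
  apply: (@le_trans _ _ (\prod_j inside_p j N x)).
    apply: ler_prod => j _; rewrite good_le andbT.
    by have [_ g01 _] := good_meas j; have /andP[] := g01 N x.
  rewrite /inside_p (exchange_big_dep G)/=; last by move=> j g _ /andP[].
  apply: ler_prod => g gG; rewrite prodr_ge0/=; last first.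
    by move=> j _; have /andP[] := p01 g x.
  have [j jg] : exists j, j \notin g.
    apply/existsP; rewrite -negb_forall; apply/negP => /forallP gT.
    suff : (#|J| <= d)%N by rewrite leqNgt dJ.
    rewrite -cardsT; apply: leq_trans (_ : #|g| <= d)%N => //.
    by apply/subset_leq_card/fintype.subsetP => k _; exact: gT.
  have lj : low (face j) d.+1 g.
    apply/andP; split => //; apply/fintype.subsetP => k kg.
    by rewrite !inE; apply: contraNneq jg => <-.
  rewrite (bigD1 j)//=; have /andP[p0 p1] := p01 g x.
  rewrite ler_piMr//; have /andP[] // := @prod_unital R J (index_enum J)
    (fun i => low (face i) d.+1 g && (i != j)) (fun=> p g N x) (fun _ _ => p01 g x).
apply: (nul_le _ (nul_mean_sqr X_gt0 h2)); apply: nearW => N.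
exact: ler_norm_mean.
Qed.

(** Whatever part of an atom a lower-level function [D] discards is charged to
    [good j] or to the failure of [At j] on the atom, since the atom has
    conditional probability [inside_p j], at most
    [good j + 2 * kappa * psi j]. *)
Lemma atom_bound j D eps : 0 < eps -> simple (face j) d D ->
  \forall N \near U, mean (fun x => inside j N x * (1 - D N x)) <=
    mean (fun x => good j N x * (1 - D N x)) +
    2 * kappa * mean (fun x => inside j N x * (1 - At j N x)) + eps.
Proof.
move=> e0 sD.
have sD' : meas U finset.setT d (fun N x => 1 - D N x).
  by apply: (simple_meas X_gt0); apply/(simple_sub (finset.subsetT _) (leqnn _))/simple_compl/sD.
have nI : nul U (fun N =>
    mean (fun x => 1 * (inside j N x * (1 - D N x))) -
    mean (fun x => 1 * (inside_p j N x * (1 - D N x)))).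
  apply: (@replace_by_projection finset.set0 (fun _ _ => 1)) => //.
  - by move=> N x; rewrite ler01 lexx.
  - by move=> g /andP[_ gd]; rewrite finset.setI0 cards0.
have s1 : simple (face j) d (fun (N : nat) (_ : {ffun J -> T N}) => 1 : R).
  by apply: (@simple_cst R J T _ _ (fun=> 1)) => N; rewrite ler01 lexx.
have e2 : 0 < eps / 2 by rewrite divr_gt0.
have e3 : 0 < eps / 2 / (2 * kappa).
  by rewrite divr_gt0// mulr_gt0// (lt_le_trans ltr01).
apply: filterS2 (nI _ e2) (psi_orth s1 e3) => N.
rewrite -!meanB ler_norml => /andP[_ H1]; rewrite ler_norml => /andP[H2 _].
have k0 : 0 < 2 * kappa by rewrite mulr_gt0// (lt_le_trans ltr01).
have {}H2 : 2 * kappa * mean (fun x => psi j N x) <=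
    2 * kappa * mean (fun x => inside j N x * (1 - At j N x)) + eps / 2.
  rewrite -(divfK (lt0r_neq0 k0) (eps / 2)) [_ / _ * _]mulrC -mulrDr ler_pM2l//.
  move: H2; under eq_mean do rewrite mulr1; rewrite meanB; lra.
have H3 : mean (fun x => inside_p j N x * (1 - D N x)) <=
    mean (fun x => good j N x * (1 - D N x)) + 2 * kappa * mean (fun x => psi j N x).
  rewrite -meanZ -meanD; apply: ler_mean => x.
  have /andP[D0 D1] := simple_unital sD x; have /andP[q0 q1] := psi01 j x.
  have kp : 0 <= 2 * kappa * psi j N x by rewrite mulr_ge0// ltW.
  have gl : inside_p j N x - 2 * kappa * psi j N x <= good j N x.
    by rewrite /good le_max lexx orbT.
  move: (2 * kappa * psi j N x) kp gl => z; nra.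
move: H1; under eq_mean do rewrite !mul1r; rewrite meanB.
by move: H2 H3; lra.
Qed.

End Level.
End Removal.

Section RemovalInduction.
Variables (R : realType) (J : finType) (T : nat -> finType) (U : set_system nat).
Context {FU : UltraFilter U}.
Hypothesis U_oo : forall n, \forall N \near U, (n <= N)%N.
Hypothesis X_gt0 : forall N, (0 < #|{ffun J -> T N}|)%N.
Hypothesis J_gt0 : (0 < #|J|)%N.

Let face (j : J) : {set J} := (~: [set j])%SET.
Let kappa : R := #|J|%:R.
Let kappa_ge1 : 1 <= kappa. Proof. by rewrite ler1n. Qed.
Let kappa_gt0 : 0 < kappa. Proof. exact: lt_le_trans kappa_ge1. Qed.

(** The removal statement for functions on the faces of a simplex that are
    measurable at level [d]. The removed sets have the same level, which is what
    lets them be used against the sparse functions modelled by [A]. *)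
Definition removal_at d := forall A : J -> ifun R J T,
  (forall j, meas U (face j) d (A j)) ->
  nul U (fun N => mean (fun x => \prod_j A j N x)) ->
  forall eps, 0 < eps -> exists A' : J -> ifun R J T,
  [/\ forall j, simple (face j) d (A' j),
      \forall N \near U, forall x, \prod_j A' j N x = 0 &
      forall j, \forall N \near U, mean (fun x => A j N x * (1 - A' j N x)) <= eps].

Lemma simple1_cst e (h : ifun R J T) : simple e 1 h -> forall N x y, h N x = h N y.
Proof.
case=> C [c [Phi [cdep _ Phidep hE]]] N x y; rewrite !hE; apply: Phidep => g.
move=> /andP[_]; rewrite ltnS leqn0 cards_eq0 => /eqP ->.
by apply: cdep => k; rewrite inE.
Qed.

Lemma pointwise_removal (a s t : R) : 0 <= a <= 1 -> 0 <= s <= 1 -> 0 <= t ->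
  a * (1 - (t < s)%R%:R) <= `|a - s| + t.
Proof.
move=> /andP[a0 a1] /andP[s0 s1] t0; have := ler_norm (a - s).
by case: ltP => H /=; have := normr_ge0 (a - s); lra.
Qed.

(** At the bottom level the functions are constants, and removing means
    discarding the small ones. *)
Lemma removal_base : removal_at 1.
Proof.
move=> A Am A0 eps e0.
(* Values up to t are discarded; the approximation error eps1 is so small that a
   product of constants above t forces the product of the A j to have mean at
   least t ^+ #|J| / 2. *)
pose t := Num.min (eps / 2) 1.
have t0 : 0 < t by rewrite lt_min divr_gt0//=.
have te : t <= eps / 2 by rewrite ge_min lexx.
have tk : 0 < t ^+ #|J| by rewrite exprn_gt0.
pose eps1 := Num.min (eps / 2) (t ^+ #|J| / (2 * kappa)).
have e1 : 0 < eps1 by rewrite lt_min !divr_gt0//= mulr_gt0.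
have ex j : exists S, simple (face j) 1 S /\
    \forall N \near U, mean (fun x => `|A j N x - S N x|) <= eps1.
  by have [_ _ /(_ _ e1)[S sS AS]] := Am j; exists S.
have [S SP] := choice ex.
exists (fun j N x => (t < S j N x)%R%:R); split.
- move=> j; apply: (simple_op1 (Th := fun _ a => (t < a)%R%:R)) (SP j).1.
  by move=> _ a _; case: (t < a); rewrite /= ?lexx ?ler01.
- have [t4 AS] := (divr_gt0 tk (ltr0Sn R 3), near_all (fun j => (SP j).2)).
  apply: filterS2 AS (A0 _ t4) => N AS; rewrite ger0_norm; last first.
    apply: mean_ge0 => x; apply: prodr_ge0 => j _.
    by have [_ A01 _] := Am j; have /andP[] := A01 N x.
  move=> AN x; apply/eqP; apply: contraTT AN => /prodf_neq0 H.
  rewrite -ltNge; have S01 j y := simple_unital (SP j).1 (N := N) y.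
  have tS : t ^+ #|J| <= mean (fun y => \prod_j S j N y).
    rewrite -[leLHS](mean_cst _ (X_gt0 N)); apply: ler_mean => y.
    rewrite -prodr_const; apply: ler_prod => j _; rewrite (ltW t0)/=.
    rewrite (simple1_cst (SP j).1 y x); have := H j isT.
    by case: (t < S j N x) / ltP => [/ltW//|_]; rewrite eqxx.
  have AS' : mean (fun y => \prod_j S j N y) <=
      mean (fun y => \prod_j A j N y) + \sum_(j : J) eps1.
    apply: (@le_trans _ _ (mean (fun y => \prod_j A j N y) +
       \sum_j mean (fun y => `|A j N y - S j N y|))).
      rewrite -mean_sum -meanD; apply: ler_mean => y; rewrite addrC -lerBlDr.
      apply: le_trans (ler_norm _) _; rewrite distrC.
      apply: ler_dist_prod => j _; last exact: S01.
      by have [_ A01 _] := Am j; exact: A01.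
    by rewrite lerD2l; apply: ler_sum => j _; exact: AS.
  have e1k : \sum_(j : J) eps1 <= t ^+ #|J| / 2.
    rewrite sumr_const -[_ *+ _]mulr_natr -/kappa -ler_pdivlMr//.
    rewrite ge_min; apply/orP; right.
    by rewrite le_eqVlt; apply/orP; left; apply/eqP; field; rewrite gt_eqF.
  by lra.
- move=> j; apply: filterS (SP j).2 => N AS.
  apply: (@le_trans _ _ (mean (fun x => `|A j N x - S j N x| + t))).
    apply: ler_mean => x; apply: pointwise_removal (ltW t0).
      by have [_ A01 _] := Am j; exact: A01.
    exact: simple_unital (SP j).1 _ _.
  rewrite meanD mean_cst// [leRHS]splitr lerD// (le_trans AS)//.
  by rewrite ge_min lexx.
Qed.

(** The atoms of a colouring adapted to the given functions are cut down to the
    places where, given the lower levels, the functions keep most of the atom.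
    Those places are measurable at the lower level with null intersection, so the
    induction hypothesis empties each of the finitely many atoms. *)
Lemma removal_step d : (0 < d)%N -> (d < #|J|)%N -> removal_at d -> removal_at d.+1.
Proof.
move=> d0 dJ IH A Am A0 eps e0.
have A01 j : unital (A j) by have [] := Am j.
(* The error eps is spent on the values below t, on the approximation error
   eps1, on its amplification by 4 * kappa / t, and on the lower level. *)
pose t := eps / 4.
have t0 : 0 < t by rewrite divr_gt0.
pose eps1 := Num.min t (t * t / (4 * kappa)).
have e1 : 0 < eps1 by rewrite lt_min t0 !divr_gt0 ?mulr_gt0.
have ex j : exists S, simple (face j) d.+1 S /\
    \forall N \near U, mean (fun x => `|A j N x - S N x|) <= eps1.
  by have [_ _ /(_ _ e1)[S sS AS]] := Am j; exists S.
have [S SP] := choice ex.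
have [C [c [Phi [cdep Phi01 Phidep SE]]]] := simple_joint (fun j => (SP j).1).
(* Colour patterns are patterns on all sets; [mask j] forgets the colours that
   the face j does not see, so that its fixed points index the atoms of j. *)
have /card_gt0P[x0 _] := X_gt0 0%N.
pose c0 : C := c finset.set0 0%N x0.
pose Gam := {ffun {set J} -> C}.
pose mask j (gam : Gam) : Gam := [ffun g => if low (face j) d.+1 g then gam g else c0].
have maskK j gam : mask j (mask j gam) = mask j gam.
  by apply/ffunP => g; rewrite !ffunE; case: (low (face j) d.+1 g).
have mask_low j gam g : low (face j) d.+1 g -> mask j gam g = gam g.
  by move=> gl; rewrite ffunE gl.
pose indc g (a : C) : ifun R J T := fun N x => (c g N x == a)%:R.
have indc01 g a : unital (indc g a).
  by move=> N x; rewrite /indc; case: eqP; rewrite /= ?lexx ?ler01.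
have indc_dep g a : idep g (indc g a).
  by move=> N x y xy; rewrite /indc (cdep g N x y).
have exP (ga : {set J} * C) : exists q, meas U ga.1 d q /\
    orth U ga.1 d (fun N x => indc ga.1 ga.2 N x - q N x).
  by have [q] := conditional_expectation1 U_oo X_gt0 ga.1 d (indc01 ga.1 ga.2); exists q.
have [pc pcP] := choice exP.
(* Rescaling makes At equal to 1 where A is at least t / 2, as the indicator of a
   set would be. *)
pose At j : ifun R J T := fun N x => Num.min 1 (2 / t * A j N x).
have t20 : 0 < 2 / t by rewrite divr_gt0.
have At01 j : unital (At j).
  move=> N x; have /andP[a0 _] := A01 j N x.
  by rewrite le_min ler01 mulr_ge0 ?(ltW t20)//= ge_min lexx.
have At_dep j : idep (face j) (At j).
  by move=> N x y xy; have [Ad _ _] := Am j; rewrite /At (Ad N x y xy).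
have At_null : nul U (fun N => mean (fun x => \prod_j At j N x)).
  apply: (nul_le _ (nulZ ((2 / t) ^+ #|J|) A0)); apply: nearW => N.
  rewrite ger0_norm; last first.
    by apply: mean_ge0 => x; apply: prodr_ge0 => j _; have /andP[] := At01 j N x.
  rewrite -meanZ; apply: ler_mean => x; rewrite -prodr_const -big_split/=.
  apply: ler_prod => j _; have /andP[-> _] /= := At01 j N x.
  by rewrite /At ge_min lexx orbT.
pose ins j (gam : Gam) : ifun R J T := fun N x =>
  \prod_(g | low (face j) d.+1 g) indc g (gam g) N x.
have ins01 j gam : unital (ins j gam).
  by move=> N x; apply: prod_unital => g _; exact: indc01.
pose fail j gam : ifun R J T := fun N x => ins j gam N x * (1 - At j N x).
have fail01 j gam : unital (fail j gam).
  move=> N x; have /andP[a0 a1] := At01 j N x; have /andP[i0 i1] := ins01 j gam N x.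
  by rewrite /fail mulr_ge0 ?subr_ge0//= mulr_ile1 ?subr_ge0//; lra.
have ins_mask j gam N x : ins j (mask j gam) N x = ins j gam N x.
  by apply: eq_bigr => g gl; rewrite mask_low.
have exPsi (ja : J * Gam) : exists q, meas U (face ja.1) d q /\
    orth U (face ja.1) d (fun N x => fail ja.1 ja.2 N x - q N x).
  by have [q] := conditional_expectation1 U_oo X_gt0 (face ja.1) d (fail01 ja.1 ja.2); exists q.
have [psic psicP] := choice exPsi.
pose psi (gam : Gam) j := psic (j, mask j gam).
pose B (gam : Gam) j := good d (fun g => pc (g, gam g)) (psi gam) j.
have B_mask gam gam' j : mask j gam = mask j gam' -> B gam j = B gam' j.
  move=> mm; apply: functional_extensionality_dep => N; apply/funext => x.
  rewrite /B /good /psi mm; congr (Num.max _ (_ - _)); apply: eq_bigr => g gl.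
  by rewrite -(mask_low j gam)// mm mask_low.
have ind01 gam g : unital (indc g (gam g)) by [].
have psi_orth gam j : orth U (face j) d (fun N x => ins j gam N x * (1 - At j N x) - psi gam j N x).
  move=> h /((psicP (j, mask j gam)).2 h); apply: eq_nul => N; apply: eq_mean => x.
  by rewrite /fail ins_mask.
have B_meas gam j : meas U (face j) d (B gam j).
  apply: good_meas => // [g|j'] ; first exact: (pcP (g, gam g)).1.
  exact: (psicP (j', mask j' gam)).1.
have exD gam : exists D : J -> ifun R J T,
   [/\ forall j, simple (face j) d (D j),
      \forall N \near U, forall x, \prod_j D j N x = 0 &
      forall j, \forall N \near U, mean (fun x => B gam j N x * (1 - D j N x)) <=
        t / 2 / (#|{: Gam}|.+1%:R * #|{: Gam}|.+1%:R)].
  apply: IH => //; last by rewrite !divr_gt0// mulr_gt0.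
  apply: (@good_null R J T U _ X_gt0 J_gt0 d (fun g => indc g (gam g))
    (fun g => pc (g, gam g)) At (psi gam)) => //.
  - by move=> g; exact: (pcP (g, gam g)).1.
  - by move=> g; exact: (pcP (g, gam g)).2.
  - by move=> j; exact: (psicP (j, mask j gam)).1.
  - exact: psi_orth.
have [D DP] := choice exD.
(* The face j does not see which full pattern extends its atom, so that it has to
   respect all of them. *)
pose D' j (al : Gam) : ifun R J T := fun N x => \prod_(gam | mask j gam == al) D gam j N x.
have sD' j al : simple (face j) d (D' j al).
  by apply: simple_prod => gam _; have [] := DP gam.
exists (fun j N x => (t < S j N x)%R%:R *
   \prod_(al | mask j al == al) (1 - ins j al N x * (1 - D' j al N x))).
have ins_neq0 j (al : Gam) N x : ins j al N x != 0 ->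
    forall g, low (face j) d.+1 g -> al g = c g N x.
  move=> /prodf_neq0 H g gl; have := H g gl.
  by rewrite /indc pnatr_eq0 eqb0 negbK => /eqP.
split.
- move=> j; apply: simpleM.
    apply: (simple_op1 (Th := fun _ a => (t < a)%R%:R)) (SP j).1.
    by move=> _ a _; case: (t < a); rewrite /= ?lexx ?ler01.
  apply: simple_prod => al _.
  apply: (simple_op2 (Th := fun _ a b => 1 - a * (1 - b)) (h1 := ins j al)).
  + move=> _ a b /andP[a0 a1] /andP[b0 b1].
    have : 0 <= a * (1 - b) <= 1 by rewrite mulr_ge0 ?subr_ge0//= mulr_ile1 ?subr_ge0//; lra.
    lra.
  + apply: simple_prod => g gl.
    apply: (simple_color (phi := fun _ a => (a == al g)%:R)) (gl) => // N a.
    by case: eqP; rewrite /= ?lexx ?ler01.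
  + by apply: simple_sub (sD' j al).
- have DU : \forall N \near U, forall gam x, \prod_j D gam j N x = 0.
    by apply: near_all => gam; have [] := DP gam.
  apply: filterS DU => N DN x.
  pose gam : Gam := [ffun g => c g N x].
  have /eqP/prodf_eq0[j _ Dj] := DN gam x.
  apply/eqP/prodf_eq0; exists j => //.
  rewrite mulf_eq0; apply/orP; right.
  apply/prodf_eq0; exists (mask j gam); first by rewrite maskK.
  rewrite ins_mask.
  have -> : ins j gam N x = 1.
    by apply: big1 => g _; rewrite /indc ffunE eqxx.
  have -> : D' j (mask j gam) N x = 0.
    by apply/eqP/prodf_eq0; exists gam.
  by rewrite subr0 mulr1 subrr.
move=> j.
pose m : R := #|{: Gam}|.+1%:R.
have m0 : 0 < m by rewrite ltr0n.
pose eps2 := t / 2 / (m * m).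
have e2 : 0 < eps2 by rewrite !divr_gt0// mulr_gt0.
have hatom al : \forall N \near U, mean (fun x => ins j al N x * (1 - D' j al N x)) <=
    mean (fun x => B al j N x * (1 - D' j al N x)) +
    2 * kappa * mean (fun x => ins j al N x * (1 - At j N x)) + eps2.
  apply: (@atom_bound R J T U _ X_gt0 J_gt0 d (fun g => indc g (al g))
    (fun g => pc (g, al g)) At (psi al)) => //.
  - by move=> g; exact: (pcP (g, al g)).1.
  - by move=> g; exact: (pcP (g, al g)).2.
  - by move=> j'; exact: (psicP (j', mask j' al)).1.
  - exact: psi_orth.
  - exact: sD'.
have hB gam : \forall N \near U, mean (fun x => B gam j N x * (1 - D gam j N x)) <= eps2.
  by have [_ _ /(_ j)] := DP gam.
apply: filterS3 (SP j).2 (near_all hatom) (near_all hB) => N AS {}hatom {}hB.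
pose b (al : Gam) : R := (t < Phi j N al)%R%:R.
have b0 al : 0 <= b al by rewrite /b; case: (t < _).
have b1 al : b al <= 1 by rewrite /b; case: (t < _).
have D01 gam x := simple_unital (let: And3 H _ _ := DP gam in H j) (N := N) x.
have D'01 al x := simple_unital (sD' j al) (N := N) x.
have insPhi al x : ins j al N x != 0 -> Phi j N al = S j N x.
  by move=> /ins_neq0 H; rewrite SE; apply: Phidep => g /H.
(* What is removed at x is a small value of A, or part of the atom of x. *)
have pointwise x : A j N x * (1 - (t < S j N x)%R%:R *
     \prod_(al | mask j al == al) (1 - ins j al N x * (1 - D' j al N x))) <=
   (`|A j N x - S j N x| + t) +
   \sum_(al | mask j al == al) b al * (ins j al N x * (1 - D' j al N x)).
  have q01 al : 0 <= ins j al N x * (1 - D' j al N x) <= 1.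
    have /andP[i0 i1] := ins01 j al N x; have /andP[d'0 d'1] := D'01 al x.
    by rewrite mulr_ge0 ?subr_ge0//= mulr_ile1 ?subr_ge0//; lra.
  have r01 al : 0 <= 1 - ins j al N x * (1 - D' j al N x) <= 1.
    by have := q01 al; lra.
  have /andP[a0 a1] := A01 j N x.
  have s0 : 0 <= \sum_(al | mask j al == al) b al * (ins j al N x * (1 - D' j al N x)).
    by apply: sumr_ge0 => al _; rewrite mulr_ge0//; have /andP[] := q01 al.
  have [tS|St] := ltP t (S j N x); last first.
    by rewrite mul0r subr0 mulr1; have := ler_norm (A j N x - S j N x); lra.
  rewrite mul1r.
  have := @one_sub_prod_le R _ (fun al => mask j al == al)
    (fun al => 1 - ins j al N x * (1 - D' j al N x)).
  move=> H; apply: (@le_trans _ _ (1 - \prod_(al | mask j al == al)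
     (1 - ins j al N x * (1 - D' j al N x)))).
    rewrite ler_piMl// subr_ge0.
    by have /andP[] := prod_unital (index_enum _) (fun al (_ : mask j al == al) => r01 al).
  apply: le_trans (H (fun al _ => r01 al)) _.
  rewrite -[leLHS]add0r lerD//; first by rewrite addr_ge0// ltW.
  apply: ler_sum => al _; rewrite opprB addrCA subrr addr0.
  have [->|/insPhi Pal] := eqVneq (ins j al N x) 0; first by rewrite !mul0r mulr0.
  by rewrite /b Pal tS mul1r.
(* Only the atom of x contributes, and there S is above t while At fails only
   where A is below t / 2. *)
have one_atom x : \sum_(al | mask j al == al) b al * (ins j al N x * (1 - At j N x)) <=
    2 / t * `|A j N x - S j N x|.
  pose gam : Gam := [ffun g => c g N x].
  have /andP[at0 at1] := At01 j N x.
  rewrite (bigD1 (mask j gam)) ?maskK//= big1 ?addr0; last first.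
    move=> al /andP[/eqP mal alg].
    have [->|/ins_neq0 H] := eqVneq (ins j al N x) 0; first by rewrite mul0r mulr0.
    case/eqP: alg; rewrite -mal; apply/ffunP => g; rewrite !ffunE.
    by case: ifP => // gl; rewrite H.
  have /andP[i0 i1] := ins01 j (mask j gam) N x.
  have -> : b (mask j gam) = (t < S j N x)%R%:R.
    rewrite /b SE; congr ((t < _)%R%:R); apply: Phidep => g gl.
    by rewrite mask_low// ffunE.
  have [tS|St] := ltP t (S j N x); last by rewrite mul0r mulr_ge0// ltW.
  rewrite mul1r (@le_trans _ _ (1 - At j N x))//.
    by rewrite ler_piMl// subr_ge0.
  rewrite /At; have [A1|A1] := leP 1 (2 / t * A j N x).
    by rewrite subrr mulr_ge0// ltW.
  apply: (@le_trans _ _ 1); first by rewrite gerBl mulr_ge0 ?(ltW t20)//; have /andP[] := A01 j N x.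
  move: A1; rewrite mulrAC ltr_pdivrMr// mul1r mulrAC ler_pdivlMr// mul1r.
  by have := ler_norm (S j N x - A j N x); rewrite distrC; lra.
apply: (le_trans (ler_mean pointwise)).
rewrite meanD meanD mean_cst// mean_sum.
have atoms : \sum_(al | mask j al == al)
    mean (fun x => b al * (ins j al N x * (1 - D' j al N x))) <= t / 2 + 2 * kappa * (2 / t * eps1).
  apply: (@le_trans _ _ (\sum_(al | mask j al == al)
     (m * eps2 + 2 * kappa * mean (fun x => b al * (ins j al N x * (1 - At j N x)))))).
    apply: ler_sum => al /eqP mal; rewrite !meanZ.
    have hBD : mean (fun x => B al j N x * (1 - D' j al N x)) <= #|{: Gam}|%:R * eps2.
      apply: (@le_trans _ _ (\sum_(gam | mask j gam == al)
          mean (fun x => B gam j N x * (1 - D gam j N x)))).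
        rewrite -mean_sum; apply: ler_mean => x.
        rewrite (eq_bigr (fun gam => B al j N x * (1 - D gam j N x))); last first.
          by move=> gam /eqP mg; rewrite (B_mask gam al j)// mg mal.
        rewrite -mulr_sumr ler_wpM2l//.
          by have [_ B01 _] := B_meas al j; have /andP[] := B01 N x.
        by apply: one_sub_prod_le => gam _; exact: D01.
      apply: (@le_trans _ _ (\sum_(gam : Gam) eps2)).
        rewrite big_mkcond; apply: ler_sum => gam _; case: ifP => // _; exact: ltW.
      by rewrite sumr_const mulr_natl.
    have mE : m = #|{: Gam}|%:R + 1 by rewrite /m -natr1.
    have := hatom al; move: hBD; rewrite mE mulrDl mul1r => hBD hat.
    apply: (@le_trans _ _ (b al * (#|{: Gam}|%:R * eps2 + eps2 +
        2 * kappa * mean (fun x => ins j al N x * (1 - At j N x))))).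
      by rewrite ler_wpM2l//; lra.
    have ne0 : 0 <= #|{: Gam}|%:R * eps2 + eps2 by apply: addr_ge0 (mulr_ge0 _ (ltW e2)) (ltW e2).
    by have := ler_piMl ne0 (b1 al); lra.
  rewrite big_split/= lerD//.
    apply: (@le_trans _ _ (\sum_(gam : Gam) m * eps2)).
      rewrite big_mkcond; apply: ler_sum => gam _; case: ifP => // _.
      exact: mulr_ge0 (ltW m0) (ltW e2).
    rewrite sumr_const -[_ *+ _]mulr_natl.
    apply: (@le_trans _ _ (m * (m * eps2))).
      apply: ler_wpM2r; first exact: mulr_ge0 (ltW m0) (ltW e2).
      by rewrite /m ler_nat.
    by rewrite le_eqVlt; apply/orP; left; apply/eqP; rewrite /eps2; field; rewrite gt_eqF.
  rewrite -mulr_sumr -mean_sum; apply: ler_wpM2l; first by rewrite mulr_ge0.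
  apply: (le_trans (ler_mean one_atom)); rewrite meanZ; apply: ler_wpM2l (AS).
  exact: ltW.
have eps1t : eps1 <= t by rewrite ge_min lexx.
have eps1k : 2 * kappa * (2 / t * eps1) <= t.
  have : eps1 <= t * t / (4 * kappa) by rewrite ge_min lexx orbT.
  rewrite ler_pdivlMr ?mulr_gt0// => H.
  have -> : 2 * kappa * (2 / t * eps1) = eps1 * (4 * kappa) / t.
    by field; rewrite gt_eqF.
  by rewrite ler_pdivrMr.
have epst : eps = 4 * t by rewrite /t; field.
by rewrite epst; move: atoms AS; lra.
Qed.

Theorem removal d : (d < #|J|)%N -> removal_at d.+1.
Proof.
elim: d => [_|d IH dJ]; first exact: removal_base.
by apply: removal_step => //; apply: IH; apply: ltnW.
Qed.

End RemovalInduction.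

(** * Majorants satisfying the linear forms condition *)

Section CauchySchwarz.
Variables (R : realType) (K : finType) (T : nat -> finType) (U : set_system nat).
Context {FU : Filter U}.

Definition swap (X : finType) (a b : K) (x : {ffun K -> X}) : {ffun K -> X} :=
  [ffun k => if k == a then x b else if k == b then x a else x k].

(** Squaring an average over the coordinate [a] produces two independent copies of
    it, for the second of which the coordinate [b] can serve. *)
Lemma mean_square_swap (X : finType) (a b : K) (G H : {ffun K -> X} -> R) :
  a != b -> dep (~: [set a; b])%SET G -> dep (~: [set b])%SET H ->
  mean (fun x => G x * (H x * H (swap a b x))) =
  mean (fun x => G x * mean (fun t => H (upd x a t)) ^+ 2).
Proof.
move=> ab Gd Hd.
have ba : (b == a) = false by rewrite eq_sym (negbTE ab).
have Ga x t : G (upd x a t) = G x by apply: dep_upd (Gd) _; rewrite !inE eqxx.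
have Gb x t : G (upd x b t) = G x.
  by apply: dep_upd (Gd) _; rewrite !inE eqxx orbT.
have Hs x : H (swap a b x) = H (upd x a (x b)).
  by apply: Hd => k; rewrite !inE !ffunE => /negbTE ->; case: (k == a).
have updb x s t : H (upd (upd x b s) a t) = H (upd x a t).
  by apply: Hd => k; rewrite !inE !ffunE => /negbTE ->; case: (k == a).
rewrite (mean_upd _ a); under eq_mean => x.
  under eq_mean => t.
    rewrite Ga Hs.
    have -> : upd (upd x a t) a (upd x a t b) = upd x a (x b).
      by apply/ffunP => k; rewrite !ffunE ba; case: (k == a).
    over.
  rewrite meanZ meanZr; over.
rewrite (mean_upd _ b); apply: eq_mean => x.
under eq_mean => s.
  rewrite Gb ffunE eqxx updb; under eq_mean => t do rewrite updb.
  over.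
by rewrite meanZ meanZ expr2.
Qed.

(** The inequality of Cauchy and Schwarz with a weight of bounded mass. *)
Lemma nul_weighted (X : nat -> finType) (F w z : forall N, X N -> R) (M : R) :
  (forall N x, `|F N x| <= w N x * `|z N x|) -> (forall N x, 0 <= w N x) ->
  (\forall N \near U, mean (w N) <= M) ->
  nul U (fun N => mean (fun x => w N x * z N x ^+ 2)) ->
  nul U (fun N => mean (F N)).
Proof.
move=> Fw w0 wM H0; apply: (nul_small (M := 1 + `|M|)) => eps e0 _.
have e2 : 0 < eps ^+ 2 by rewrite exprn_gt0.
apply: filterS2 (H0 _ e2) wM => N /(le_trans (ler_norm _)) HN MN.
apply: (le_trans (ler_norm_mean _)).
apply: (@le_trans _ _ (mean (fun x => w N x * z N x ^+ 2 * (eps^-1 / 2) + w N x * (eps / 2)))).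
  apply: ler_mean => x; apply: (le_trans (Fw N x)).
  rewrite -mulrA -mulrDr ler_wpM2l//; apply: (le_trans (ler_abs_amgm _ e0)).
  by rewrite le_eqVlt; apply/orP; left; apply/eqP; field; rewrite gt_eqF.
rewrite meanD !meanZr; apply: (@le_trans _ _ (eps ^+ 2 * (eps^-1 / 2) + `|M| * (eps / 2))).
  apply: lerD; rewrite ler_pM2r ?divr_gt0 ?invr_gt0//.
  by rewrite (le_trans MN)// ler_norm.
have -> : eps ^+ 2 * (eps^-1 / 2) = eps / 2 by field; rewrite gt_eqF.
by have := normr_ge0 M; nra.
Qed.

(** One step of doubling: a factor [G] independent of the coordinate [a] is replaced
    by its majorant, at the price of doubling [a] in the other factors. *)
Lemma nul_cauchy_schwarz (a b : K) (G G' H : ifun R K T) (M : R) :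
  a != b -> (forall N x, 0 <= G N x <= G' N x) ->
  idep (~: [set a; b])%SET G -> idep (~: [set a; b])%SET G' ->
  idep (~: [set b])%SET H -> (\forall N \near U, mean (G' N) <= M) ->
  nul U (fun N => mean (fun x => G' N x * (H N x * H N (swap a b x)))) ->
  nul U (fun N => mean (fun x => G N x * H N x)).
Proof.
move=> ab GG' Gd G'd Hd G'M H0.
pose Hb N x := mean (fun t => H N (upd x a t)).
apply: (eq_nul (u := fun N => mean (fun x => G N x * Hb N x))) => [N|].
  rewrite [RHS](mean_upd _ a); apply: eq_mean => x; rewrite -meanZ.
  apply: eq_mean => t; congr (_ * _); apply/esym.
  by apply: dep_upd (Gd N) _; rewrite !inE eqxx.
apply: (nul_weighted (w := G') (z := Hb)) (G'M) _ => [N x|N x|].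
- have /andP[g0 gg] := GG' N x; rewrite normrM (ger0_norm g0).
  by rewrite ler_wpM2r.
- by have /andP[g0 gg] := GG' N x; rewrite (le_trans g0).
- by apply: (eq_nul _ H0) => N; exact: (mean_square_swap ab (G'd N) (Hd N)).
Qed.

End CauchySchwarz.

Section DoubledPoints.
Variables (R : realType) (J X : finType).
Implicit Types (S : {set J}) (p : {ffun J * bool -> X}).

(** A point [p] stands for a pair of points of [X ^ J]; [pt S p] takes the second
    one on [S] and the first one elsewhere. *)
Definition pt S p : {ffun J -> X} := [ffun j => p (j, j \in S)].

Lemma pt_setU1 i S p : i \notin S ->
  pt (i |: S)%SET p = pt S (swap (i, false) (i, true) p).
Proof.
move=> iS; apply/ffunP => j; rewrite !ffunE !inE !xpair_eqE.
have [->|ji] /= := eqVneq j i; first by rewrite (negbTE iS).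
by [].
Qed.

Lemma mean_pt (F H : {ffun J -> X} -> R) o :
  mean (fun p => F (pt finset.set0 p) * H (pt [set o]%SET p)) =
  mean (fun x => mean (fun t => F (upd x o t)) * mean (fun t => H (upd x o t))).
Proof.
case: (posnP #|X|) => [X0|X0].
  rewrite /mean !big1 ?mul0r// => [x|p] _; first by have := card0_eq X0 (x o).
  by have := card0_eq X0 (p (o, true)).
have XJ : (0 < #|{ffun J -> X}|)%N.
  have /card_gt0P[x0 _] := X0; by apply/card_gt0P; exists [ffun=> x0].
pose h (xy : {ffun J -> X} * {ffun J -> X}) : {ffun J * bool -> X} :=
  [ffun jb : J * bool => (if jb.2 then xy.2 else xy.1) jb.1].
have hb : bijective h.
  exists (fun p => (pt finset.set0 p, pt [set: J]%SET p)) => [[x y]|p].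
    by congr (_, _); apply/ffunP => j; rewrite !ffunE /= !inE.
  by apply/ffunP => -[j b]; rewrite !ffunE /=; case: b; rewrite ffunE !inE.
rewrite -(mean_reindex _ hb).
have -> : mean (fun xy => F (pt finset.set0 (h xy)) * H (pt [set o]%SET (h xy))) =
    mean (fun xy : {ffun J -> X} * {ffun J -> X} => F xy.1 * H (upd xy.1 o (xy.2 o))).
  apply: eq_mean => -[x y] /=; congr (F _ * H _); apply/ffunP => j.
    by rewrite !ffunE /= !inE.
  by rewrite !ffunE /= !inE; case: eqP => [->|].
rewrite (mean_pair (fun x (y : {ffun J -> X}) => F x * H (upd x o (y o)))).
have avg x : mean (fun y : {ffun J -> X} => H (upd x o (y o))) = mean (fun t => H (upd x o t)).
  rewrite (mean_upd _ o) -[RHS](mean_cst _ XJ); apply: eq_mean => y.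
  by apply: eq_mean => t; rewrite ffunE eqxx.
under eq_mean do rewrite meanZ avg.
rewrite (mean_upd _ o); apply: eq_mean => x; rewrite -meanZr; apply: eq_mean => t.
congr (_ * _); apply: eq_mean => s; congr H; apply/ffunP => j; rewrite !ffunE.
by case: eqP.
Qed.

Lemma prod_subsetU1 (A : {set J}) i (c : pred {set J}) (F : {set J} -> R) :
  i \notin A -> (forall S, c (i |: S)%SET = c S) ->
  \prod_(S : {set J} | (S \subset (i |: A)%SET) && c S) F S =
  \prod_(S : {set J} | (S \subset A) && c S) (F S * F (i |: S)%SET).
Proof.
move=> iA ci; rewrite big_split /= (bigID (fun S : {set J} => i \in S)) /= mulrC.
congr (_ * _).
  apply: eq_bigl => S; rewrite andbAC; congr (_ && _).
  apply/andP/idP => [[SA iS]|SA].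
    apply/fintype.subsetP => k kS; have := fintype.subsetP SA k kS.
    by rewrite !inE => /predU1P[ki|//]; rewrite -ki kS in iS.
  split; last by apply: contra iA; apply: fintype.subsetP.
  by apply: fintype.subset_trans SA _; apply: finset.subsetUr.
rewrite (reindex_onto (fun S => i |: S)%SET (fun S => S :\ i)%SET) /=; last first.
  by move=> S /andP[_ iS]; rewrite finset.setD1K.
apply: eq_bigl => S; rewrite ci finset.setU11 andbT andbAC; congr (_ && _).
apply/andP/idP => [[SA /eqP SE]|SA].
  apply/fintype.subsetP => k kS.
  have ki : k != i by move: kS; rewrite -SE !inE => /andP[].
  have : k \in (i |: A)%SET by apply: (fintype.subsetP SA); rewrite !inE kS orbT.
  by rewrite !inE (negbTE ki).
have iS : i \notin S by apply: contra iA; apply: fintype.subsetP.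
split; first by apply: finset.setUS.
by rewrite finset.setU1K.
Qed.

End DoubledPoints.

Section LinearForms.
Variables (R : realType) (J : finType) (T : nat -> finType) (U : set_system nat).
Context {FU : UltraFilter U}.
Hypothesis T_gt0 : forall N, (0 < #|T N|)%N.
Variable nu : J -> ifun R J T.
Arguments nu : clear implicits.

Let face (j : J) : {set J} := (~: [set j])%SET.
Let W (n : J -> {set J} -> bool) N (p : {ffun J * bool -> T N}) : R :=
  \prod_j \prod_(S : {set J} | j \notin S) nu j N (pt S p) ^+ n j S.
Arguments W : clear implicits.

Hypothesis nu_dep : forall j, idep (face j) (nu j).
Hypothesis linear_forms : forall n, nul U (fun N => mean (W n N) - 1).

Let W_set1 (n : J -> {set J} -> bool) (o : J) (S0 : {set J}) N p : o \notin S0 -> n o S0 = false ->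
  W (fun j S => (j == o) && (S == S0) || n j S) N p = nu o N (pt S0 p) * W n N p.
Proof.
move=> oS0 n0; rewrite /W (bigD1 o)//= [in RHS](bigD1 o)//= mulrA; congr (_ * _).
  rewrite (bigD1 S0)//= [in RHS](bigD1 S0)//= !eqxx n0 expr0 mul1r expr1.
  by congr (_ * _); apply: eq_bigr => S /andP[_ /negbTE ->]; rewrite andbF.
by apply: eq_bigr => j /negbTE ->; apply: eq_bigr.
Qed.

(** Expanding the factors [nu o - 1] gives signed products of majorants, all with
    mean tending to 1; the signs cancel as soon as there is one such factor. *)
Lemma alternating_forms (o : J) (s : seq {set J}) (n : J -> {set J} -> bool) : uniq s ->
  {in s, forall S : {set J}, o \notin S /\ n o S = false} ->
  nul U (fun N => mean (fun p => \prod_(S <- s) (nu o N (pt S p) - 1) * W n N p)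
    - (s == [::])%:R).
Proof.
elim: s n => [|S0 s IH] n /=.
  move=> _ _; apply: eq_nul (linear_forms n) => N; congr (_ - _).
  by apply: eq_mean => p; rewrite big_nil mul1r.
move=> /andP[S0s us] sP; have [oS0 n0] := sP S0 (mem_head _ _).
have H1 := IH (fun j S => (j == o) && (S == S0) || n j S) us.
have H2 := IH n us.
apply: (eq_nul _ (nulB (H1 _) (H2 _))) => [N|S Ss|S Ss].
- rewrite subr0 opprB addrA subrK -meanB; apply: eq_mean => p.
  by rewrite W_set1// big_cons; ring.
- have [oS nS] := sP S (mem_behead (s := S0 :: s) Ss); split => //.
  by rewrite eqxx nS orbF /=; apply: contraNF S0s => /eqP <-.
- exact: sP (mem_behead (s := S0 :: s) Ss).
Qed.

Section Strong.
Variables (o : J) (f : J -> bool -> ifun R J T) (fl : J -> bool -> bool).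
Arguments f : clear implicits.
Hypothesis f_bound : forall i b N x, 0 <= f i b N x <= nu i N x ^+ fl i b.
Hypothesis f_dep : forall i b, idep (face i) (f i b).

Let factor (I : {set J}) i b N x :=
  if i \in I then nu i N x ^+ fl i b else f i b N x.

(** The form obtained after the variables in [I] have been doubled: every
    function with index in [I] has been replaced by its majorant. *)
Let Q (I : {set J}) N (p : {ffun J * bool -> T N}) : R :=
  \prod_(S : {set J} | S \subset I) (nu o N (pt S p) - 1) *
  \prod_(i | i != o) \prod_(S : {set J} | (S \subset o |: I)%SET && (i \notin S))
    factor I i (o \in S) (pt S p).

(** Doubling the variables one after the other only increases the form, up to
    squares and bounded factors; in the end all functions have been replaced by
    majorants and the linear forms condition applies. *)
Lemma doubled_forms (I : {set J}) : o \notin I -> nul U (fun N => mean (Q I (N := N))).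
Proof.
move: {2}#|(~: (o |: I))%SET| (leqnn #|(~: (o |: I))%SET|) => n.
elim: n I => [|n IH] I.
  rewrite leqn0 cards_eq0 => /eqP oI oNI.
  have oIT : (o |: I)%SET = [set: J]%SET by rewrite -(finset.setCK (o |: I)%SET) oI finset.setC0.
  have SI (S : {set J}) : (S \subset I) = (o \notin S).
    apply/idP/idP => [SI|oS]; first by apply: contra oNI; apply: fintype.subsetP.
    apply/fintype.subsetP => k kS; have : k \in (o |: I)%SET by rewrite oIT inE.
    by rewrite !inE => /predU1P[ko|//]; rewrite -ko kS in oS.
  pose s := enum [set S : {set J} | o \notin S]%SET.
  have sP (S : {set J}) : (S \in s) = (o \notin S) by rewrite mem_enum inE.
  have := @alternating_forms o s (fun j S => (j != o) && fl j (o \in S)) (enum_uniq _).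
  move=> H; apply: (eq_nul _ (H _)) => [N|S].
    have -> : (s == [::]) = false.
      by apply/eqP => s0; have := sP finset.set0; rewrite s0 inE finset.in_set0.
    rewrite subr0; apply: eq_mean => p; rewrite /Q; congr (_ * _).
      by rewrite /s big_enum/=; apply: eq_bigl => S; rewrite inE SI.
    rewrite /W (bigD1 o)//= big1 ?mul1r => [|S _]; last by rewrite eqxx expr0.
    apply: eq_bigr => i io; apply: eq_big => [S|S _]; first by rewrite oIT finset.subsetT.
    have : i \in (o |: I)%SET by rewrite oIT inE.
    by rewrite /factor !inE (negbTE io) /= => ->.
  by rewrite sP eqxx.
move=> cI oNI; have [oIT|] := eqVneq (~: (o |: I))%SET finset.set0.
  by apply: IH => //; rewrite oIT cards0.
case/finset.set0Pn => i; rewrite !inE negb_or => /andP[io iI].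
have iS (S : {set J}) : (S \subset I) -> i \notin S.
  by move=> /fintype.subsetP SI; apply: contra iI => /SI.
have iS' (S : {set J}) : (S \subset (o |: I)%SET) -> i \notin S.
  by move=> /fintype.subsetP SI; apply/negP => /SI; rewrite !inE (negbTE io) (negbTE iI).
pose inner (g : J -> bool -> ifun R J T) j N (p : {ffun J * bool -> T N}) :=
  \prod_(S : {set J} | (S \subset o |: I)%SET && (j \notin S)) g j (o \in S) N (pt S p).
pose G N p := inner f i N p.
pose G' N p := inner (fun j b N x => nu j N x ^+ fl j b) i N p.
pose H N p := \prod_(S : {set J} | S \subset I) (nu o N (pt S p) - 1) *
  \prod_(j | (j != o) && (j != i)) inner (factor I) j N p.
have pt_eq (N : nat) (S : {set J}) (k : J) (p p' : {ffun J * bool -> T N}) :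
    i \notin S -> {in (~: [set (i, false); (i, true)])%SET, p =1 p'} ->
    {in face i, pt S p =1 pt S p'}.
  move=> _ pp' j; rewrite !inE => ji; rewrite !ffunE; apply: pp'.
  by rewrite !inE !xpair_eqE (negbTE ji).
have pt_eq' (N : nat) (S : {set J}) (p p' : {ffun J * bool -> T N}) :
    i \notin S -> {in (~: [set (i, true)])%SET, p =1 p'} -> pt S p = pt S p'.
  move=> {}iS pp'; apply/ffunP => j; rewrite !ffunE; apply: pp'.
  rewrite !inE !xpair_eqE; apply/negP => /andP[/eqP -> /eqP iS'']; move: iS.
  by rewrite iS''.
apply: (eq_nul (u := fun N => mean (fun p => G N p * H N p))) => [N|].
  apply: eq_mean => p; rewrite /Q [in RHS](bigD1 i)//= mulrCA; congr (_ * (_ * _)).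
  by apply: eq_bigr => S _; rewrite /factor (negbTE iI).
have ab : (i, false) != (i, true) by rewrite xpair_eqE andbF.
apply: (@nul_cauchy_schwarz _ _ _ _ _ _ _ G G' H 2 ab).
- move=> N p; rewrite prodr_ge0/=; last by move=> S _; have /andP[] := f_bound i (o \in S) (pt S p).
  by apply: ler_prod => S _; exact: f_bound.
- move=> N p p' pp'; apply: eq_bigr => S /andP[SI iNS].
  by apply: f_dep; apply: pt_eq.
- move=> N p p' pp'; apply: eq_bigr => S /andP[SI iNS]; congr (_ ^+ _).
  by apply: nu_dep; apply: pt_eq.
- move=> N p p' pp'; congr (_ * _).
    by apply: eq_bigr => S /iS SI; rewrite (pt_eq' N S p p').
  by apply: eq_bigr => j _; apply: eq_bigr => S /andP[/iS' SI _]; rewrite (pt_eq' N S p p').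
- have -> : (2 : R) = 1 + 1 by rewrite -natr1.
  apply: nul_near_le.
  apply: (eq_nul _ (linear_forms (fun j S =>
    [&& j == i, S \subset (o |: I)%SET & fl i (o \in S)]))) => N.
  congr (_ - _); apply: eq_mean => p; rewrite /W (bigD1 i)//= [X in _ * X]big1 ?mulr1; last first.
    by move=> j /negbTE -> ; apply: big1 => S _; rewrite expr0.
  rewrite /G' /inner [in LHS]big_mkcond [in RHS]big_mkcond; apply: eq_bigr => S _ /=.
  rewrite eqxx /=; case: (boolP (S \subset _)) => [SI|SI] /=; first by rewrite iS'.
  by case: (i \in S).
have oiI : o \notin (i |: I)%SET by rewrite !inE eq_sym (negbTE io).
have oi : (o == i) = false by rewrite eq_sym (negbTE io).
have {}IH := IH (i |: I)%SET _ oiI.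
apply: (eq_nul _ (IH _)) => [N|]; last first.
  rewrite -ltnS; apply: leq_trans cI; apply: proper_card.
  rewrite finset.setUCA fintype.properE !finset.setCS finset.subsetUr /=.
  apply/negP => /fintype.subsetP /(_ i); rewrite !inE eqxx (negbTE io) (negbTE iI).
  by move=> /(_ isT).
apply: eq_mean => p; rewrite /Q.
have -> : \prod_(S : {set J} | S \subset (i |: I)%SET) (nu o N (pt S p) - 1) =
    \prod_(S : {set J} | S \subset I) (nu o N (pt S p) - 1) *
    \prod_(S : {set J} | S \subset I) (nu o N (pt S (swap (i, false) (i, true) p)) - 1).
  rewrite -big_split /=.
  transitivity (\prod_(S : {set J} | (S \subset (i |: I)%SET) && true) (nu o N (pt S p) - 1)).
    by apply: eq_bigl => S; rewrite andbT.
  rewrite (prod_subsetU1 (c := xpredT))//; apply: eq_big => [S|S]; first by rewrite andbT.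
  by rewrite andbT => /iS SI; rewrite pt_setU1.
rewrite (bigD1 i)//=.
have -> : \prod_(S : {set J} | (S \subset (o |: (i |: I))%SET) && (i \notin S))
    factor (i |: I)%SET i (o \in S) (pt S p) = G' N p.
  apply: eq_big => [S|S _]; last by rewrite /factor finset.setU11.
  rewrite finset.setUCA; apply: andb_id2r => iNS; apply/idP/idP => [|SI]; last first.
    by apply: fintype.subset_trans SI _; apply: finset.subsetUr.
  move=> /fintype.subsetP SI; apply/fintype.subsetP => k kS; have := SI k kS.
  by rewrite !inE => /predU1P[ki|//]; rewrite -ki kS in iNS.
have -> : \prod_(j | (j != o) && (j != i))
    \prod_(S : {set J} | (S \subset (o |: (i |: I))%SET) && (j \notin S))
    factor (i |: I)%SET j (o \in S) (pt S p) =
  \prod_(j | (j != o) && (j != i)) inner (factor I) j N p *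
  \prod_(j | (j != o) && (j != i)) inner (factor I) j N (swap (i, false) (i, true) p).
  rewrite -big_split /=; apply: eq_bigr => j /andP[jo ji].
  rewrite finset.setUCA (prod_subsetU1 (c := fun S : {set J} => j \notin S)).
  - rewrite /inner -big_split /=; apply: eq_bigr => S /andP[/iS' SI _].
    rewrite pt_setU1// /factor !inE (negbTE ji) oi /=.
    by case: (j \in I).
  - by rewrite !inE (negbTE io).
  - by move=> S; rewrite !inE (negbTE ji).
rewrite /H; ring.
Qed.

(** The majorant [nu o] may be replaced by 1 against two independent families of
    functions bounded by the other majorants. *)
Theorem strong_linear_forms :
  nul U (fun N => mean (fun x => (nu o N x - 1) *
    (mean (fun t => \prod_(i | i != o) f i false N (upd x o t)) *
     mean (fun t => \prod_(i | i != o) f i true N (upd x o t))))).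
Proof.
have o0 : o \notin (finset.set0 : {set J}) by rewrite inE.
apply: (eq_nul _ (doubled_forms o0)) => N.
transitivity (mean (fun p => ((nu o N (pt finset.set0 p) - 1) *
    \prod_(i | i != o) f i false N (pt finset.set0 p)) *
    \prod_(i | i != o) f i true N (pt [set o]%SET p))).
  apply: eq_mean => p; rewrite /Q -mulrA; congr (_ * _).
    by rewrite (big_pred1 finset.set0)// => S; rewrite finset.subset0.
  rewrite -big_split /=; apply: eq_bigr => i io.
  rewrite (prod_subsetU1 (c := fun S : {set J} => i \notin S))//; last first.
    by move=> S; rewrite !inE (negbTE io).
  rewrite (big_pred1 finset.set0) => [|S].
    by rewrite /factor !inE eqxx finset.setU0.
  by rewrite finset.subset0 /=; case: eqP => // ->; rewrite inE.
rewrite (mean_pt (fun x => (nu o N x - 1) * \prod_(i | i != o) f i false N x)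
  (fun x => \prod_(i | i != o) f i true N x)).
apply: eq_mean => x; rewrite mulrA; congr (_ * _); rewrite -meanZ.
apply: eq_mean => t; congr ((_ - _) * _); apply: (dep_upd (e := face o)).
  exact: nu_dep.
by rewrite !inE eqxx.
Qed.

End Strong.

Lemma mean_majorant_pairs o (fl : J -> bool -> bool) :
  nul U (fun N => mean (fun x =>
    mean (fun t => \prod_(i | i != o) nu i N (upd x o t) ^+ fl i false) *
    mean (fun t => \prod_(i | i != o) nu i N (upd x o t) ^+ fl i true)) - 1).
Proof.
apply: (eq_nul _ (linear_forms (fun j S => (j != o) &&
  ((S == finset.set0) && fl j false || (S == [set o]%SET) && fl j true)))) => N.
congr (_ - _).
rewrite -(mean_pt (fun x => \prod_(i | i != o) nu i N x ^+ fl i false)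
  (fun x => \prod_(i | i != o) nu i N x ^+ fl i true)).
apply: eq_mean => p; rewrite /W (bigD1 o)//= big1 ?mul1r => [|S _]; last first.
  by rewrite eqxx expr0.
rewrite -big_split /=; apply: eq_bigr => i io.
have o0 : ([set o]%SET == finset.set0 :> {set J}) = false.
  by apply/negbTE/finset.set0Pn; exists o; rewrite inE.
rewrite (bigD1 finset.set0)/= ?inE// (bigD1 [set o]%SET)/= ?inE ?io ?o0//.
rewrite ?io !eqxx [finset.set0 == _]eq_sym o0 /= orbF big1 ?mulr1// => S.
by rewrite -andbA => /and3P[_ /negbTE -> /negbTE ->]; rewrite expr0.
Qed.

Lemma mean_majorant o : nul U (fun N => mean (nu o N) - 1).
Proof.
apply: (eq_nul _ (linear_forms (fun j S => (j == o) && (S == finset.set0)))) => N.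
congr (_ - _); transitivity (mean (fun p => nu o N (pt finset.set0 p) * 1)).
  apply: eq_mean => p; rewrite /W (bigD1 o)//= [X in _ * X]big1 ?mulr1; last first.
    by move=> j /negbTE ->; apply: big1 => S _; rewrite expr0.
  rewrite (bigD1 finset.set0)/= ?inE// !eqxx expr1 big1 ?mulr1// => S.
  by move=> /andP[_ /negbTE ->]; rewrite andbF expr0.
rewrite (mean_pt (nu o N) (fun=> 1) o) [RHS](mean_upd _ o); apply: eq_mean => x.
by rewrite mean_cst ?mulr1.
Qed.

End LinearForms.

(** * Counting relative to the majorants *)

Section Counting.
Variables (R : realType) (J : finType) (T : nat -> finType) (U : set_system nat).
Context {FU : UltraFilter U}.
Hypothesis T_gt0 : forall N, (0 < #|T N|)%N.
Variable nu : J -> ifun R J T.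
Arguments nu : clear implicits.

Let face (j : J) : {set J} := (~: [set j])%SET.

Hypothesis nu_ge0 : forall j N x, 0 <= nu j N x.
Hypothesis nu_dep : forall j, idep (face j) (nu j).
Hypothesis linear_forms : forall n : J -> {set J} -> bool,
  nul U (fun N => mean (fun p : {ffun J * bool -> T N} =>
    \prod_j \prod_(S : {set J} | j \notin S) nu j N (pt S p) ^+ n j S) - 1).

Let X_gt0 N : (0 < #|{ffun J -> T N}|)%N.
Proof. by have /card_gt0P[t _] := T_gt0 N; apply/card_gt0P; exists [ffun=> t]. Qed.

Let mean_nu o : \forall N \near U, mean (nu o N) <= 2.
Proof.
have -> : (2 : R) = 1 + 1 by rewrite -natr1.
by apply: nul_near_le; apply: mean_majorant.
Qed.

(** A simple function of the coordinates in [face o] is a combination of products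
    of functions each missing one more coordinate, which the linear forms
    condition cannot distinguish [nu o] from 1 by. *)
Lemma majorant_orth o : orth U (face o) #|J|.-1 (fun N x => nu o N x - 1).
Proof.
move=> h [C [c [Phi [cdep Phi01 Phidep hE]]]].
have /card_gt0P[x0 _] := X_gt0 0%N.
pose c0 : C := c finset.set0 0%N x0.
pose lo := low (face o) #|J|.-1.
pose mask (gam : {ffun {set J} -> C}) : {ffun {set J} -> C} :=
  [ffun g => if lo g then gam g else c0].
have maskK gam : mask (mask gam) = mask gam.
  by apply/ffunP => g; rewrite !ffunE; case: (lo g).
pose ind g (a : C) : ifun R J T := fun N x => (c g N x == a)%:R.
pose ins (al : {ffun {set J} -> C}) : ifun R J T := fun N x => \prod_(g | lo g) ind g (al g) N x.
have h_sum N x : h N x = \sum_(al | mask al == al) Phi N al * ins al N x.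
  pose gam : {ffun {set J} -> C} := [ffun g => c g N x].
  rewrite (bigD1 (mask gam)) ?maskK//= big1 ?addr0; last first.
    move=> al /andP[/eqP mal alg]; rewrite [ins _ _ _](_ : _ = 0) ?mulr0//.
    apply/eqP; apply: contraNT alg => /prodf_neq0 H; rewrite -mal.
    apply/eqP/ffunP => g; rewrite !ffunE; case: ifP => // gl.
    by have := H g gl; rewrite /ind pnatr_eq0 eqb0 negbK => /eqP.
  have -> : ins (mask gam) N x = 1.
    by apply: big1 => g gl; rewrite /ind !ffunE gl eqxx.
  by rewrite mulr1 hE; apply: Phidep => g gl; rewrite !ffunE (gl : lo g = true).
have missing g : lo g -> exists i, (i != o) && (i \notin g).
  move=> /andP[_ gJ]; apply/existsP; apply: contraLR gJ; rewrite negb_exists => /forallP H.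
  rewrite -leqNgt.
  rewrite (_ : #|J|.-1 = #|face o|); last by rewrite cardsC1.
  apply/subset_leq_card/fintype.subsetP => i; rewrite !inE => io.
  by have := H i; rewrite io /= negbK.
pose pick (g : {set J}) := odflt o [pick i | (i != o) && (i \notin g)].
have pick_ok g : lo g -> (pick g != o) && (pick g \notin g).
  rewrite /pick => /missing[i iP]; case: pickP => [//|/(_ i)].
  by rewrite iP.
have ins_orth al : nul U (fun N => mean (fun x => (nu o N x - 1) * ins al N x)).
  pose u i : ifun R J T := fun N x => \prod_(g | lo g && (pick g == i)) ind g (al g) N x.
  pose f i (b : bool) : ifun R J T := if b then fun _ _ => 1 else u i.
  have ind01 g a : unital (ind g a).
    by move=> N x; rewrite /ind; case: eqP; rewrite /= ?lexx ?ler01.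
  have f_bound i b N x : 0 <= f i b N x <= nu i N x ^+ false.
    rewrite expr0 /f; case: b; first by rewrite ler01 lexx.
    by apply: prod_unital => g _; exact: ind01.
  have f_dep i b : idep (face i) (f i b).
    rewrite /f; case: b => // N x y xy; apply: eq_bigr => g /andP[gl /eqP pg].
    rewrite /ind (cdep g N x y)// => k kg; apply: xy; rewrite !inE -pg.
    by apply: contraTneq kg => ->; have /andP[] := pick_ok g gl.
  have := @strong_linear_forms R J T U FU nu nu_dep linear_forms o f
    (fun _ _ => false) f_bound f_dep.
  move=> H; apply: (eq_nul _ H) => N; apply: eq_mean => x; congr (_ * _).
  rewrite [X in _ * X](_ : _ = 1) ?mulr1; last first.
    by under eq_mean do rewrite big1//; rewrite mean_cst.
  rewrite -[RHS](mean_cst _ (T_gt0 N)); apply: eq_mean => t.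
  rewrite /ins (partition_big pick (fun i => i != o)) /=; last first.
    by move=> g /pick_ok/andP[].
  apply: eq_bigr => i io; apply: eq_bigr => g /andP[/andP[ge _] _].
  rewrite /ind (dep_upd _ _ (cdep g N))//.
  by apply/negP => /(fintype.subsetP ge); rewrite !inE eqxx.
apply: (eq_nul (u := fun N => \sum_(al | mask al == al)
   Phi N al * mean (fun x => (nu o N x - 1) * ins al N x))) => [N|].
  under eq_bigr do rewrite -meanZ; rewrite -mean_sum; apply: eq_mean => x.
  by rewrite h_sum mulr_sumr; apply: eq_bigr => al _; rewrite mulrCA.
apply: nul_sum => al _; apply: (nulM (M := 1)) (ins_orth al).
by apply: nearW => N; have /andP[P0 P1] := Phi01 N al; rewrite ger0_norm.
Qed.

(** Infinitesimal cut norm on the face opposite to [j]: the coordinate [j] in the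
    tests may be averaged out or fixed without changing the notion. *)
Definition cut_null j (u : ifun R J T) := forall w : J -> ifun R J T,
  (forall i, unital (w i)) -> (forall i, idep (face i) (w i)) ->
  nul U (fun N => mean (fun x => u N x * \prod_(i | i != j) w i N x)).

(** Bounded factors are replaced one at a time, the others serving as test
    functions. *)
Lemma dense_counting (f g : J -> ifun R J T) :
  (forall j, unital (f j)) -> (forall j, unital (g j)) ->
  (forall j, idep (face j) (f j)) -> (forall j, idep (face j) (g j)) ->
  (forall j, cut_null j (fun N x => f j N x - g j N x)) ->
  nul U (fun N => mean (fun x => \prod_j f j N x) - mean (fun x => \prod_j g j N x)).
Proof.
move=> f01 g01 fd gd fg; pose mix (l : seq J) j := if j \in l then g j else f j.
have mix01 l i : unital (mix l i) by rewrite /mix; case: ifP.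
have mixd l i : idep (face i) (mix l i) by rewrite /mix; case: ifP.
suff H l : uniq l -> nul U (fun N => mean (fun x => \prod_j f j N x) -
    mean (fun x => \prod_j mix l j N x)).
  apply: (eq_nul _ (H (enum J) (enum_uniq _))) => N; congr (_ - _).
  by apply: eq_mean => x; apply: eq_bigr => j _; rewrite /mix mem_enum.
elim: l => [_|o l IH /= /andP[ol ul]].
  apply: (eq_nul _ (@nul0 R U _)) => N; apply/esym/eqP; rewrite subr_eq0; apply/eqP.
  by apply: eq_mean => x; apply: eq_bigr.
apply: (eq_nul _ (nulD (IH ul) (fg o (mix l) (mix01 l) (mixd l)))) => N.
rewrite -!meanB -meanD; apply: eq_mean => x.
rewrite (bigD1 o)//= [X in _ - X + _](bigD1 o)//= [X in _ = _ - X](bigD1 o)//=.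
rewrite [X in _ - X * _](_ : _ = f o N x); last by rewrite /mix (negbTE ol).
rewrite [X in _ = _ - X * _](_ : _ = g o N x); last by rewrite /mix mem_head.
rewrite [X in _ = _ - _ * X](_ : _ = \prod_(i | i != o) mix l i N x); last first.
  by apply: eq_bigr => i /negbTE io; rewrite /mix inE io.
ring.
Qed.

Let avg o (F : ifun R J T) : ifun R J T := fun N x => mean (fun t => F N (upd x o t)).
Arguments avg : clear implicits.

Let mean_avg o (H F : ifun R J T) : idep (face o) H ->
  forall N, mean (fun x => H N x * avg o F N x) = mean (fun x => H N x * F N x).
Proof.
move=> Hd N; rewrite [RHS](mean_upd _ o); apply: eq_mean => x; rewrite -meanZ.
by apply: eq_mean => t; rewrite (dep_upd _ _ (Hd N))// !inE eqxx.
Qed.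

Let avg_dep o F : idep (face o) (avg o F).
Proof.
move=> N x y xy; apply: eq_mean => t; congr (F N _); apply/ffunP => k.
by rewrite !ffunE; case: eqP => // /eqP ko; apply: xy; rewrite !inE.
Qed.

Let truncation_error (a b g : R) : 0 <= a <= b -> 0 <= g <= 1 ->
  `|(a - Num.min a 1) * (a - g)| <= `|b - 1| + (b - 1) ^+ 2.
Proof.
move=> /andP[a0 ab] /andP[g0 g1]; have [a1|a1] := leP a 1.
  by rewrite subrr mul0r normr0 addr_ge0 ?sqr_ge0.
rewrite !ger0_norm ?mulr_ge0 ?subr_ge0//; try lra.
by nra.
Qed.

(** Averaging out the coordinate [o] densifies: the average of the other factors
    is bounded by an average of majorants, which is close to 1 in L2, so that it
    can be truncated to a bounded function and takes the place of the sparse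
    factor [o] in a count with fewer sparse factors. *)
Theorem relative_counting (S : {set J}) (f g : J -> ifun R J T) :
  (forall j N x, 0 <= f j N x <= nu j N x ^+ (j \in S)) -> (forall j, unital (g j)) ->
  (forall j, idep (face j) (f j)) -> (forall j, idep (face j) (g j)) ->
  (forall j, cut_null j (fun N x => f j N x - g j N x)) ->
  nul U (fun N => mean (fun x => \prod_j f j N x) - mean (fun x => \prod_j g j N x)).
Proof.
move: {2}#|S| (erefl #|S|) => n; elim: n S f g => [|n IH] S f g.
  move=> /eqP; rewrite cards_eq0 => /eqP ->; move=> f_bound g01 fd gd fg.
  by apply: dense_counting => // j N x; have := f_bound j N x; rewrite inE.
move=> Sn f_bound g01 fd gd fg.
have [ o oS] : exists o, o \in S by apply/finset.set0Pn; rewrite -cards_eq0 Sn.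
pose rest (F : J -> ifun R J T) : ifun R J T := fun N x => \prod_(i | i != o) F i N x.
pose nuS i : ifun R J T := fun N x => nu i N x ^+ (i \in S).
pose f' := avg o (rest f); pose g' := avg o (rest g); pose nu' := avg o (rest nuS).
have f'_bound N x : 0 <= f' N x <= nu' N x.
  apply/andP; split.
    by apply: mean_ge0 => t; apply: prodr_ge0 => i _; have /andP[] := f_bound i N (upd x o t).
  by apply: ler_mean => t; apply: ler_prod => i _; exact: f_bound.
have g_01 : unital g'.
  move=> N x; rewrite mean_ge0/= => [|t]; last first.
    by apply: prodr_ge0 => i _; have /andP[] := g01 i N (upd x o t).
  apply: mean_le_cst => // t.
  by have /andP[] := prod_unital (index_enum J) (fun i (_ : i != o) => g01 i N (upd x o t)).
have fdo := fd o; have gdo := gd o.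
have splitE (F : J -> ifun R J T) N : idep (face o) (F o) ->
    mean (fun x => \prod_j F j N x) = mean (fun x => F o N x * avg o (rest F) N x).
  by move=> Fo; rewrite mean_avg//; apply: eq_mean => x; rewrite (bigD1 o).
(* Both families of factors other than [o] may be tested against [nu o]. *)
have strong (a b : bool) : nul U (fun N => mean (fun x => (nu o N x - 1) *
    (avg o (rest (if a then f else g)) N x * avg o (rest (if b then f else g)) N x))).
  pose F i (c : bool) := if (if c then b else a) then f i else g i.
  have F_bound i c N x : 0 <= F i c N x <= nu i N x ^+ ((if c then b else a) && (i \in S)).
    rewrite /F; case: (if c then b else a) => /=; [exact: f_bound|exact: g01].
  have F_dep i c : idep (face i) (F i c).
    by rewrite /F; case: (if c then b else a).
  have := @strong_linear_forms R J T U FU nu nu_dep linear_forms o F _ F_bound F_dep.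
  apply: eq_nul => N; apply: eq_mean => x; congr (_ * (_ * _)).
    by apply: eq_mean => t; apply: eq_bigr => i _; rewrite /F; case: ifP.
  by apply: eq_mean => t; apply: eq_bigr => i _; rewrite /F; case: ifP.
have nu'_sqr : nul U (fun N => mean (fun x => (nu' N x - 1) ^+ 2)).
  have H2 : nul U (fun N => mean (fun x => nu' N x * nu' N x) - 1).
    exact: (@mean_majorant_pairs R J T U FU nu linear_forms o (fun i _ => i \in S)).
  have H1 : nul U (fun N => mean (nu' N) - 1).
    have H := @mean_majorant_pairs R J T U FU nu linear_forms o
      (fun i b => ~~ b && (i \in S)).
    apply: (eq_nul _ H) => N; congr (_ - _); apply: eq_mean => x.
    rewrite [X in _ * X](_ : _ = 1) ?mulr1//.
    by under eq_mean do rewrite big1//; rewrite mean_cst.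
  apply: (eq_nul _ (nulB H2 (nulZ 2 H1))) => N.
  have -> : mean (fun x => (nu' N x - 1) ^+ 2) =
      mean (fun x => nu' N x * nu' N x) - 2 * mean (nu' N) + 1.
    rewrite -[X in _ = _ + X](mean_cst _ (X_gt0 N)) -meanZ -meanB -meanD.
    by apply: eq_mean => x; ring.
  ring.
have nu'_abs : nul U (fun N => mean (fun x => `|nu' N x - 1|)).
  exact: (nul_mean_sqr (h := fun N x => nu' N x - 1)).
(* Bounded functions may be tested by induction. *)
have tested (h : ifun R J T) : unital h -> idep (face o) h ->
    nul U (fun N => mean (fun x => h N x * f' N x) - mean (fun x => h N x * g' N x)).
  move=> h01 hd; pose put (F : J -> ifun R J T) j := if j == o then h else F j.
  have putE (F : J -> ifun R J T) N :
      mean (fun x => \prod_j put F j N x) = mean (fun x => h N x * avg o (rest F) N x).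
    rewrite mean_avg//; apply: eq_mean => x; rewrite (bigD1 o)//= /put eqxx.
    by congr (_ * _); apply: eq_bigr => i /negbTE ->.
  have := IH (S :\ o)%SET (put f) (put g).
  move=> H; apply: (eq_nul _ (H _ _ _ _ _ _)) => [N| |j N x|j|j|j|j].
  - by rewrite !putE.
  - by move: Sn; rewrite (cardsD1 o) oS => -[].
  - rewrite /put !inE; case: eqP => [_|_] /=; [exact: h01|exact: f_bound].
  - by rewrite /put; case: eqP.
  - by rewrite /put; case: eqP => [->|].
  - by rewrite /put; case: eqP => [->|].
  - rewrite /put; case: eqP => [_|_]; last exact: fg.
    move=> w _ _; apply: (eq_nul _ (@nul0 R U _)) => N.
    by under eq_mean do rewrite subrr mul0r; rewrite mean_cst.
have z_sqr : nul U (fun N => mean (fun x => (f' N x - g' N x) ^+ 2)).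
  pose m : ifun R J T := fun N x => Num.min (f' N x) 1.
  have m01 : unital m.
    move=> N x; have /andP[f0 _] := f'_bound N x.
    by rewrite le_min f0 ler01 ge_min lexx orbT.
  have md : idep (face o) m by move=> N x y xy; rewrite /m /f' (avg_dep _ xy).
  have H1 : nul U (fun N => mean (fun x => (f' N x - m N x) * (f' N x - g' N x))).
    apply: (nul_le _ (nulD nu'_abs nu'_sqr)); apply: nearW => N.
    apply: (le_trans (ler_norm_mean _)); rewrite -meanD; apply: ler_mean => x.
    exact: truncation_error.
  have g'd : idep (face o) g' by exact: avg_dep.
  apply: (eq_nul _ (nulD H1 (nulB (tested m m01 md) (tested g' g_01 g'd)))) => N.
  by rewrite -!meanB -meanD; apply: eq_mean => x; ring.
have part1 : nul U (fun N => mean (fun x => f o N x * (f' N x - g' N x))).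
  apply: (nul_weighted (w := nu o) (z := fun N x => f' N x - g' N x)) (mean_nu o) _ => //.
    move=> N x; have := f_bound o N x; rewrite oS expr1 => /andP[f0 fn].
    by rewrite normrM ger0_norm// ler_wpM2r.
  apply: (eq_nul _ (nulD (nulB (strong true true) (nulZ 2 (strong true false)))
    (nulD (strong false false) z_sqr))) => N.
  rewrite -meanZ -meanB -!meanD; apply: eq_mean => x /=.
  rewrite -/f' -/g'; ring.
have part2 := fg o g g01 gd.
apply: (eq_nul _ (nulD part1 part2)) => N.
have fgd : idep (face o) (fun N x => f o N x - g o N x).
  by move=> N' x y xy; rewrite (fdo N' x y xy) (gdo N' x y xy).
rewrite !splitE// -(mean_avg (rest g) fgd) -meanD -meanB; apply: eq_mean => x.
rewrite -/f' -/g'; ring.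
Qed.

End Counting.

(** * Averages over finite abelian groups *)

(** A map that intertwines enough translations preserves uniform averages; the
    sizes of its fibres do not have to be compared. *)
Lemma mean_pushforward (R : realType) (X Y : finType) (theta : X -> Y)
    (F : Y -> R) (sX : Y -> X -> X) (sY : Y -> Y -> Y) :
  (0 < #|X|)%N -> (0 < #|Y|)%N -> (forall z, bijective (sX z)) ->
  (forall y, bijective (sY^~ y)) ->
  (forall z x, F (theta (sX z x)) = F (sY z (theta x))) ->
  mean (fun x => F (theta x)) = mean F.
Proof.
move=> X0 Y0 sXb sYb sXY; rewrite -[LHS](mean_cst _ Y0).
rewrite (@eq_mean _ _ _ (fun z => mean (fun x => F (sY z (theta x))))) => [|z].
  rewrite mean_exchange -[RHS](mean_cst _ X0); apply: eq_mean => x.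
  exact: (mean_reindex F (sYb _)).
rewrite -(mean_reindex (fun x => F (theta x)) (sXb z)).
by apply: eq_mean => x; rewrite sXY.
Qed.

Section Groups.
Variables (R : realType) (J : finType) (Z Z' : finZmodType).
Variable phi : J -> {additive Z -> Z'}.
Hypothesis J_gt0 : (0 < #|J|)%N.
Hypothesis phi_gen : <<[set u : Z' | [exists i : J, exists j : J, exists d : Z,
  u == phi i d - phi j d]]%SET>>%g = [set: Z']%SET.

Implicit Types x y w : {ffun J -> Z}.

(** The argument of [nu] on the edge opposite to [j]; it is the point
    [a + phi j d] of the configuration given by [a = \sum_i phi i (x i)] and
    [d = - \sum_i x i]. *)
Definition vertex_form j x : Z' := \sum_i (phi i (x i) - phi j (x i)).

Let total x : Z' := \sum_i phi i (x i).

Lemma vertex_formE j x : vertex_form j x = total x - phi j (\sum_i x i).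
Proof. by rewrite /vertex_form /total sumrB (raddf_sum (phi j)). Qed.

Lemma vertex_form_dep j : dep (~: [set j])%SET (vertex_form j).
Proof.
move=> x y xy; apply: eq_bigr => i _.
have [->|ij] := eqVneq i j; first by rewrite !subrr.
by rewrite xy// !inE.
Qed.

Lemma totalD x y : total (x + y) = total x + total y.
Proof. by rewrite -big_split; apply: eq_bigr => i _; rewrite ffunE raddfD. Qed.

Lemma sum_ffunD x y : \sum_i (x + y) i = \sum_i x i + \sum_i y i.
Proof. by rewrite -big_split; apply: eq_bigr => i _; rewrite ffunE. Qed.

(** The values of [total] on the hyperplane of vanishing sums form a subgroup
    containing the generators. *)
Lemma total_surjective a : exists2 x : {ffun J -> Z}, \sum_i x i = 0 & total x = a.
Proof.
pose G := [set b : Z' | `[< exists2 x : {ffun J -> Z}, \sum_i x i = 0 & total x = b >]]%SET.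
have GG : group_set G.
  apply/group_setP; split.
    rewrite finset.in_set; apply/asboolP; exists 0.
      by apply: big1 => i _; rewrite ffunE.
    rewrite -[RHS]/(0 : Z'); apply: big1 => i _; rewrite ffunE raddf0 //.
  move=> b c; rewrite !finset.in_set => /asboolP[x x0 <-] /asboolP[y y0 <-].
  apply/asboolP; rewrite [(_ * _)%g]/(total x + total y).
  exists (x + y); first by rewrite sum_ffunD x0 y0 addr0.
  by rewrite totalD.
suff : (<<[set u : Z' | [exists i : J, exists j : J, exists d : Z,
  u == phi i d - phi j d]]%SET>>%g \subset Group GG).
  rewrite phi_gen => /fintype.subsetP /(_ a); rewrite finset.in_setT => /(_ isT).
  by rewrite /= finset.in_set => /asboolP.
rewrite gen_subG; apply/fintype.subsetP => u; rewrite !finset.in_set.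
move=> /existsP[i /existsP[j /existsP[d /eqP ->]]]; apply/asboolP.
pose at_ (k : J) (c : Z) : {ffun J -> Z} := [ffun l => if l == k then c else 0].
have sum_at k c : \sum_l at_ k c l = c.
  by rewrite (bigD1 k)//= big1 ?addr0 => [|l /negbTE lk]; rewrite ffunE ?eqxx ?lk.
have total_at k c : total (at_ k c) = phi k c.
  rewrite /total (bigD1 k)//= big1 ?addr0 => [|l /negbTE lk]; rewrite ffunE ?eqxx//.
  by rewrite lk raddf0.
exists (at_ i d + at_ j (- d)); first by rewrite sum_ffunD !sum_at subrr.
by rewrite totalD !total_at raddfN.
Qed.

Let X_gt0 : (0 < #|{ffun J -> Z}|)%N.
Proof. by apply/card_gt0P; exists 0. Qed.

Let translateX_bij w : bijective (fun x => x + w).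
Proof. by exists (fun y => y - w) => y; rewrite ?addrK ?subrK. Qed.

(** The parametrization of configurations by [Z ^ J] is a surjective homomorphism:
    this is where the generation hypothesis enters. *)
Lemma mean_configurations (F : J -> Z' -> R) :
  mean (fun ad : Z' * Z => \prod_j F j (ad.1 + phi j ad.2)) =
  mean (fun x => \prod_j F j (vertex_form j x)).
Proof.
pose theta x := (total x, - \sum_i x i).
have surj ad : exists w, theta w = ad.
  case: ad => a d; have /card_gt0P[k _] := J_gt0.
  pose x0 : {ffun J -> Z} := [ffun l => if l == k then - d else 0].
  have sum0 : \sum_l x0 l = - d.
    by rewrite (bigD1 k)//= big1 ?addr0 => [|l /negbTE lk]; rewrite ffunE ?eqxx ?lk.
  have [x1 s1 t1] := total_surjective (a - total x0).
  exists (x0 + x1); rewrite /theta totalD sum_ffunD t1 s1 addr0 sum0 opprK.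
  by rewrite addrC subrK.
pose w ad := sval (cid (surj ad)).
have wE ad : theta (w ad) = ad by exact: (svalP (cid (surj ad))).
have thetaD x y : theta (x + y) = theta x + theta y.
  by rewrite /theta totalD sum_ffunD opprD.
rewrite -(@mean_pushforward R _ _ theta _ (fun z x => x + w z) (fun z u => u + z)).
- by apply: eq_mean => x; apply: eq_bigr => j _; rewrite vertex_formE /= raddfN.
- exact: X_gt0.
- by apply/card_gt0P; exists 0.
- by move=> z; exact: translateX_bij.
- by move=> v; exists (fun u => u - v) => u; rewrite [v + _]addrC ?addrK ?subrK.
- by move=> z x; rewrite thetaD wE.
Qed.

(** On the hyperplane of vanishing sums all the vertex forms coincide, so that no
    point of it escapes the removed sets; and it projects bijectively to each
    face. *)
Lemma mean_le_removed (f : Z' -> R) (A : J -> {ffun J -> Z} -> R) :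
  (forall a, 0 <= f a) -> (forall j x, 0 <= A j x <= 1) ->
  (forall j, dep (~: [set j])%SET (A j)) -> (forall x, \prod_j A j x = 0) ->
  mean f <= \sum_j mean (fun x => f (vertex_form j x) * (1 - A j x)).
Proof.
move=> f0 A01 Ad A0; have /card_gt0P[ o _] := J_gt0.
pose proj (j : J) y := upd y j (- \sum_(i | i != j) y i).
have sum_proj j y : \sum_i proj j y i = 0.
  rewrite (bigD1 j)//= ffunE eqxx addrC; apply/eqP; rewrite subr_eq0; apply/eqP.
  by apply: eq_bigr => i /negbTE ij; rewrite ffunE ij.
have proj_id j y : \sum_i y i = 0 -> proj j y = y.
  move=> y0; apply/ffunP => i; rewrite ffunE; case: eqP => [->|//].
  by apply/esym/eqP; move/eqP: y0; rewrite (bigD1 j)//= addr_eq0.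
have projD y z : proj o (y + z) = proj o y + proj o z.
  apply/ffunP => i; rewrite !ffunE; case: eqP => // _.
  by rewrite -opprD -big_split; congr (- _); apply: eq_bigr => k _; rewrite ffunE.
pose del := proj o.
have f_del : mean f = mean (fun y => f (total (del y))).
  have surj a : exists y, total (del y) = a.
    by have [y y0 <-] := total_surjective a; exists y; rewrite /del proj_id.
  pose w a := sval (cid (surj a)).
  have wE a : total (del (w a)) = a by exact: (svalP (cid (surj a))).
  symmetry; apply: (@mean_pushforward R _ _ (fun y => total (del y)) f
    (fun z x => x + w z) (fun z u => u + z)) => //.
  - by apply/card_gt0P; exists 0.
  - by move=> z x; rewrite /del projD totalD wE.
have face_del j (G : {ffun J -> Z} -> R) : dep (~: [set j])%SET G ->
    mean G = mean (fun y => G (del y)).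
  move=> Gd; symmetry; apply: (@mean_pushforward R _ _ del G
    (fun z x => x + proj j z) (fun z u => u + z)) => //.
  - move=> z x; rewrite /del projD (proj_id o (proj j z))//.
    by apply: Gd => i; rewrite !inE !ffunE => /negbTE ->.
rewrite f_del.
under eq_bigr => j _.
  rewrite (face_del j (fun x => f (vertex_form j x) * (1 - A j x))); last first.
    by move=> x y xy; rewrite (vertex_form_dep xy) (Ad j x y xy).
  over.
rewrite -mean_sum; apply: ler_mean => y.
have /eqP/prodf_eq0[j _ /eqP Aj] := A0 (del y).
rewrite (bigD1 j)//= Aj subr0 mulr1 vertex_formE sum_proj raddf0 subr0.
rewrite lerDl; apply: sumr_ge0 => i _; rewrite mulr_ge0// subr_ge0.
by have /andP[] := A01 i (del y).
Qed.

End Groups.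

(** * The linear forms condition of the simplex system *)

Section SimplexForms.
Variables (R : realType) (J : finType) (J_gt1 : (1 < #|J|)%N).
Variables (Z Z' : finZmodType) (phi : J -> {additive Z -> Z'}).
Variables (nu : Z' -> R) (nu_ge0 : forall x, 0 <= nu x).

Let V := simplex_system J_gt1 Z.

Let edge_proof (j : J) : (~: [set j])%SET \in hsH V.
Proof. by rewrite inE cardsC1. Qed.

Let edge (j : J) : {e : {set hsJ V} | e \in hsH V} := Sub (~: [set j])%SET (edge_proof j).

Let apex (e : {e : {set hsJ V} | e \in hsH V}) : J :=
  if [pick j | j \notin val e] is Some j then j
  else xchoose (elimT card_gt0P (ltnW J_gt1)).

Let apexK : cancel edge apex.
Proof.
move=> j; rewrite /apex /=; case: pickP => [k|/(_ j)]; rewrite !inE negbK.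
  by move/eqP.
by rewrite eqxx.
Qed.

Let edgeK : cancel apex edge.
Proof.
move=> e; apply: val_inj; rewrite /= /apex.
have He : #|val e| = #|J|.-1 by have := valP e; rewrite inE => /eqP.
case: pickP => [j je|H].
  apply/esym/eqP; rewrite eqEcard He cardsC1 leqnn andbT.
  by apply/fintype.subsetP => i ie; rewrite !inE; apply: contraTneq ie => ->.
have eT : val e = [set: J]%SET by apply/setP => i; rewrite finset.in_setT; apply/negbFE/H.
have lt : (#|val e| < #|J|)%N by rewrite He ltn_predL ltnW.
by exfalso; move: lt; rewrite eT cardsT ltnn.
Qed.

Let bits (j : J) (S : {set J}) : {ffun {i : J | i \in ~: [set j]%SET} -> bool} :=
  [ffun i => val i \in S].
Let ones (e : {set J}) (om : {ffun {i : J | i \in e} -> bool}) : {set J} :=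
  [set val i | i in [set i | om i]]%SET.

Let mem_ones (e : {set J}) (om : {ffun {i : J | i \in e} -> bool}) (i : {i : J | i \in e}) :
  (val i \in ones om) = om i.
Proof.
apply/imsetP/idP => [[k]|omi]; last by exists i; rewrite ?inE.
by rewrite inE => omk /val_inj ->.
Qed.

(** An edge is determined by the vertex it omits, and a choice of copies on it by
    the set of coordinates that use the second copy. *)
Lemma simplex_forms tau :
  (forall n : forall e : {e : {set hsJ V} | e \in hsH V},
         {ffun {j : hsJ V | j \in val e} -> bool} -> bool,
  `| mean (fun x : Vfull V * Vfull V =>
       \prod_(e : {e : {set hsJ V} | e \in hsH V})
       \prod_(omega : {ffun {j : hsJ V | j \in val e} -> bool})
         simplex_weight J_gt1 phi nu_ge0 e (cube_point x omega) ^+ n e omega) - 1 | <= tau) ->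
  forall n : J -> {set J} -> bool,
  `| mean (fun p : {ffun J * bool -> Z} =>
      \prod_j \prod_(S : {set J} | j \notin S)
        nu (vertex_form phi j (pt S p)) ^+ n j S) - 1 | <= tau.
Proof.
move=> lf n.
apply: le_trans (lf (fun e om => n (apex e) (ones om))).
rewrite le_eqVlt; apply/orP; left; apply/eqP; congr `|_ - 1|.
pose h (p : {ffun J * bool -> Z}) : Vfull V * Vfull V :=
  (finfun (fun j : hsJ V => p (j, false)) : Vfull V,
   finfun (fun j : hsJ V => p (j, true)) : Vfull V).
have hb : bijective h.
  exists (fun xy : Vfull V * Vfull V => [ffun jb : J * bool => (if jb.2 then xy.2 else xy.1) jb.1]).
    by move=> p; apply/ffunP => -[j b]; rewrite !ffunE /=; case: b; rewrite ffunE.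
  by move=> [x y]; congr (_, _); apply/ffunP => j; rewrite !ffunE.
rewrite -(mean_reindex _ hb); apply: eq_mean => p.
rewrite [RHS](reindex edge) /=; last by exists apex => ? _; [exact: apexK|exact: edgeK].
apply: eq_bigr => j _.
rewrite (reindex_onto (@ones (~: [set j])%SET) (bits j)) /=; last first.
  move=> S jS; apply/setP => i; apply/imsetP/idP => [[k]|iS].
    by rewrite !inE ffunE => kS ->.
  have ij : i \in (~: [set j])%SET by rewrite !inE; apply: contraNneq jS => <-.
  by exists (Sub i ij); rewrite // inE ffunE.
apply: eq_big => [om|om _].
  apply/andP; split.
    by apply/negP => /imsetP[k _ jk]; have := valP k; rewrite -jk !inE eqxx.
  by apply/eqP/ffunP => i; rewrite ffunE mem_ones.
rewrite apexK; congr (_ ^+ _).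
rewrite simplex_weight_funE; congr nu.
rewrite /vertex_form (bigD1 j)//= subrr add0r.
transitivity (\sum_(i in (~: [set j])%SET) (phi i (pt (ones om) p i) - phi j (pt (ones om) p i))).
  by apply: eq_bigl => i; rewrite !inE.
rewrite (big_sub _ (fun i => phi i (pt (ones om) p i) - phi j (pt (ones om) p i))).
apply: eq_bigr => i _; rewrite /cube_point !ffunE mem_ones /=.
by case: (om i); rewrite ffunE.
Qed.

End SimplexForms.

(** * The theorem *)

Section Contradiction.
Variables (R : realType) (J : finType) (J_gt1 : (1 < #|J|)%N) (delta : R).
Hypothesis delta_gt0 : 0 < delta.

(** Data for one value of [N] violating the conclusion with constant [eps], although
    the linear forms have error at most [eps]. *)
Record counterexample (eps : R) := Counterexample {
  ceZ : finZmodType;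
  ceZ' : finZmodType;
  cephi : J -> {additive ceZ -> ceZ'};
  cenu : ceZ' -> R;
  cef : ceZ' -> R;
  ce_gen : <<[set u : ceZ' | [exists i : J, exists j : J, exists d : ceZ,
    u == cephi i d - cephi j d]]%SET>>%g = [set: ceZ']%SET;
  ce_nu_ge0 : forall x, 0 <= cenu x;
  ce_forms : forall n : J -> {set J} -> bool,
    `| mean (fun p : {ffun J * bool -> ceZ} =>
        \prod_j \prod_(S : {set J} | j \notin S)
          cenu (vertex_form cephi j (pt S p)) ^+ n j S) - 1 | <= eps;
  ce_bound : forall x, 0 <= cef x <= cenu x;
  ce_mean : delta <= mean cef;
  ce_few : mean (fun ad : ceZ' * ceZ => \prod_j cef (ad.1 + cephi j ad.2)) < eps
}.

(** Along an ultrafilter a sequence of ever better counterexamples has exact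
    linear forms and no configurations; then the dense models have no simplices,
    and removing few of their edges destroys the whole mass of [f], which sits on
    degenerate simplices. *)
Lemma no_counterexamples : (forall m, counterexample m.+1%:R^-1) -> False.
Proof.
move=> d; pose T N : finType := ceZ (d N).
have [U [UU sU]] := ultraFilterLemma (eventually_filter : ProperFilter \oo%classic).
have U_oo n : \forall N \near U, (n <= N)%N by apply: sU; exact: nbhs_infty_ge.
have inv_null : nul U (fun N => N.+1%:R^-1 : R).
  move=> eps e0; apply: sU.
  have := near_infty_natSinv_lt (PosNum e0); apply: filterS => N /=.
  by rewrite ger0_norm ?invr_ge0// => /ltW.
have T_gt0 N : (0 < #|T N|)%N by apply/card_gt0P; exists (0 : ceZ (d N)).
have X_gt0 N : (0 < #|{ffun J -> T N}|)%N.
  by apply/card_gt0P; exists [ffun=> (0 : ceZ (d N))].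
have J_gt0 : (0 < #|J|)%N by exact: ltnW.
pose face (j : J) := (~: [set j])%SET.
pose L j N (x : {ffun J -> T N}) := vertex_form (@cephi _ (d N)) j x.
pose nu j : ifun R J T := fun N x => @cenu _ (d N) (L j N x).
pose f j : ifun R J T := fun N x => @cef _ (d N) (L j N x).
have L_dep j N : dep (face j) (L j N) by exact: vertex_form_dep.
have nu_dep j : idep (face j) (nu j) by move=> N x y xy; rewrite /nu (L_dep j N x y).
have f_dep j : idep (face j) (f j) by move=> N x y xy; rewrite /f (L_dep j N x y).
have nu_ge0 j N x : 0 <= nu j N x by exact: ce_nu_ge0.
have f_bound j N x : 0 <= f j N x <= nu j N x by exact: ce_bound.
have forms (n : J -> {set J} -> bool) : nul U (fun N =>
    mean (fun p : {ffun J * bool -> T N} =>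
    \prod_j \prod_(S : {set J} | j \notin S) nu j N (pt S p) ^+ n j S) - 1).
  by apply: nul_le inv_null; apply: nearW => N; exact: ce_forms.
(* Dense models of the copies of f on the faces. *)
have [g gP] : exists g, forall j, meas U (face j) #|J|.-1 (g j) /\
    orth U (face j) #|J|.-1 (fun N x => f j N x - g j N x).
  suff : forall j, exists g, meas U (face j) #|J|.-1 g /\
    orth U (face j) #|J|.-1 (fun N x => f j N x - g N x) by move=> /choice[g]; exists g.
  move=> j.
  have nu_orth : orth U (face j) #|J|.-1 (fun N x => nu j N x - 1).
    exact: majorant_orth.
  by have [g] := conditional_expectation U_oo X_gt0 (f_bound j) nu_orth; exists g.
have g01 j : unital (g j) by have [[]] := gP j.
have g_dep j : idep (face j) (g j) by have [[]] := gP j.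
(* A test function of another face only meets the face j in |J| - 2 coordinates. *)
have fg_cut j : cut_null U j (fun N x => f j N x - g j N x).
  move=> w w01 w_dep.
  pose s i : {set J} := if i == j then finset.set0 else face i.
  pose w' i : ifun R J T := if i == j then fun _ _ => 1 else w i.
  have H : nul U (fun N => mean (fun x => (f j N x - g j N x) * (\prod_i w' i N x * 1))).
    apply: (@orth_prod R J T U UU X_gt0 J s w' (face j) #|J|.-1 _ (fun _ _ => 1) 3).
    - by move=> N x y xy; rewrite (f_dep j N x y xy) (g_dep j N x y xy).
    - have nuM : \forall N \near U, mean (nu j N) <= 1 + 1.
        by apply: nul_near_le; exact: mean_majorant.
      apply: filterS nuM => N nuN.
      apply: (@le_trans _ _ (mean (fun x => nu j N x + 1))).
        apply: ler_mean => x; have /andP[f0 fn] := f_bound j N x.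
        have /andP[g0 g1] := g01 j N x; rewrite ler_norml; lra.
      by rewrite meanD mean_cst//; lra.
    - exact: (gP j).2.
    - by rewrite /w' => i; case: eqP => // _ N x; rewrite ler01 lexx.
    - by rewrite /w' /s => i; case: eqP => // _; exact: w_dep.
    - rewrite /s => i; case: eqP => [_|/eqP ij].
        by rewrite finset.set0I cards0 -ltnS prednK.
      apply: card_setI_lt; rewrite ?cardsC1//.
      by apply: contra ij => /eqP/finset.setC_inj/finset.set1_inj ->.
    - by apply: (@simple_cst R J T _ _ (fun=> 1)) => N; rewrite ler01 lexx.
  apply: (eq_nul _ H) => N; apply: eq_mean => x; congr (_ * _).
  rewrite mulr1 (bigD1 j)//= {1}/w' eqxx mul1r.
  by apply: eq_bigr => i /negbTE ij; rewrite /w' ij.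
have f_null : nul U (fun N => mean (fun x => \prod_j f j N x)).
  apply: nul_le inv_null; apply: nearW => N; rewrite ger0_norm; last first.
    by apply: mean_ge0 => x; apply: prodr_ge0 => j _; have /andP[] := f_bound j N x.
  have := ltW (ce_few (d N)).
  by rewrite (mean_configurations J_gt0 (ce_gen (d N)) (fun=> @cef _ (d N))).
have g_null : nul U (fun N => mean (fun x => \prod_j g j N x)).
  have H := @relative_counting R J T U UU T_gt0 nu nu_ge0 nu_dep forms finset.setT f g.
  apply: (eq_nul _ (nulB f_null (H _ _ _ _ _))) => // [N|j N x]; first by ring.
  by rewrite finset.in_setT expr1.
have J0 : 0 < #|J|%:R :> R by rewrite ltr0n.
pose eps := delta / (4 * #|J|%:R).
have e0 : 0 < eps by rewrite divr_gt0// mulr_gt0.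
have J2 : #|J|.-2.+1 = #|J|.-1 by rewrite prednK// -ltnS prednK.
have J2J : (#|J|.-2 < #|J|)%N by rewrite J2 -ltnS prednK// ltnW.
have rem : removal_at R J T U #|J|.-1 by rewrite -J2; exact: removal.
have [A [sA A0 gA]] := rem g (fun j => (gP j).1) g_null eps e0.
have fA j : \forall N \near U, mean (fun x => f j N x * (1 - A j N x)) <= 2 * eps.
  have := (gP j).2 _ (simple_compl (sA j)) _ e0; apply: filterS2 (gA j) => N gN.
  move=> /(le_trans (ler_norm _)) fgN.
  have -> : mean (fun x => f j N x * (1 - A j N x)) =
      mean (fun x => g j N x * (1 - A j N x)) + mean (fun x => (f j N x - g j N x) * (1 - A j N x)).
    by rewrite -meanD; apply: eq_mean => x; ring.
  lra.
(* At a single index the removal contradicts the lower bound on the mean of f. *)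
have [N [A0N fAN]] := filter_ex (filterI A0 (near_all fA)).
have : mean (@cef _ (d N)) <= \sum_j mean (fun x => f j N x * (1 - A j N x)).
  apply: (mean_le_removed J_gt0 (ce_gen (d N))) => //.
  - by move=> a; have /andP[] := ce_bound (c := d N) a.
  - by move=> j x; exact: simple_unital (sA j) _ _.
  - by move=> j; exact: simple_idep (sA j) _.
move=> /(le_trans (ce_mean (d N))); apply/negP; rewrite -ltNge.
apply: (@le_lt_trans _ _ (\sum_(j : J) 2 * eps)); first by apply: ler_sum => j _.
rewrite sumr_const -[_ *+ _]mulr_natr.
have -> : 2 * eps * #|J|%:R = delta / 2 by rewrite /eps; field; rewrite gt_eqF.
by rewrite gtr_pMr// invf_lt1// ltr1n.
Qed.

End Contradiction.

Theorem theorem3p1 (R : realType) (J : finType) (J_gt1 : (1 < #|J|)%N)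
    (delta : R) (delta_gt0 : 0 < delta) :
  exists2 c : R, 0 < c &
  forall tau : nat -> R, (tau @ \oo --> (0 : R))%classic ->
  exists N0 : nat,
  forall (Z Z' : nat -> finZmodType)
    (phi : forall N, J -> {additive Z N -> Z' N})
    (phi_gen : forall N,
       <<[set u : Z' N |
            [exists i : J, exists j : J, exists d : Z N,
               u == phi N i d - phi N j d]]%SET>>%g = [set: Z' N]%SET)
    (nu : forall N, Z' N -> R) (nu_ge0 : forall N x, 0 <= nu N x)
    (nu_lf : linear_forms_condition
       (fun N => simplex_weight J_gt1 (phi N) (nu_ge0 N)) tau)
    (N : nat) (N_ge : (N0 <= N)%N) (f : Z' N -> R)
    (f_bound : forall x, 0 <= f x <= nu N x) (f_mean : delta <= mean f),
  c <= mean (fun ad : Z' N * Z N => \prod_(j : J) f (ad.1 + phi N j ad.2)).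
Proof.
have [c c0 noce] : exists2 c : R, 0 < c & ~ inhabited (counterexample J delta c).
  apply: contrapT => H; apply: (no_counterexamples J_gt1 delta_gt0) => m.
  apply: inhabited_witness; apply: contrapT => noce; apply: H.
  by exists m.+1%:R^-1; rewrite ?invr_gt0.
exists c => // tau tau0.
have [N0 _ tauP] : \forall N \near \oo%classic, `|0 - tau N| <= c.
  by have /cvgrPdist_le/(_ c c0) := tau0.
exists N0 => Z Z' phi phi_gen nu nu_ge0 nu_lf N N_ge f f_bound f_mean.
rewrite leNgt; apply/negP => few; apply: noce; constructor.
apply: (@Counterexample R J delta c (Z N) (Z' N) (phi N) (nu N) f) => // n.
apply: le_trans (simplex_forms (nu_lf N) n) _.
by have := tauP N N_ge; rewrite /= sub0r normrN; apply: le_trans; exact: ler_norm.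
Qed.
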